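(* Let $R$ be an associative unital ring, let $\kappa\geq\operatorname{card}(R)+\aleph_0$ be a cardinal, let $\mathcal{D}$ be a $\kappa^+$-deconstructible class of right $R$-modules, and let $\mathcal{M}$ be either the class of all embeddings, all RD-embeddings, or all pure embeddings. If $\mathbf{D}=(\mathcal{D},\leq_{\mathcal{M}})$ has the amalgamation property, then $\mathbf{D}$ is $\kappa$-tame.
   Context: Modules are right $R$-modules; $\|M\|$ denotes the cardinality of a module $M$. For an infinite cardinal $\mu$, a module is $<\mu$-presented if it has a presentation with fewer than $\mu$ generators and fewer than $\mu$ relations. For a class $\mathcal{C}$ of modules, a module $M$ is $\mathcal{C}$-filtered if there are an ordinal $\delta$ and an increasing chain of submodules $(M_i\mid i\leq\delta)$ of $M$ with $M_0=0$, $M_\delta=M$, $M_i=\bigcup_{j<i}M_j$ for limit $i\leq\delta$, and $M_{i+1}/M_i$ isomorphic to a member of $\mathcal{C}$ for all $i<\delta$. A class $\mathcal{D}$ is $\mu$-deconstructible if $\mathcal{D}$ is exactly the class of all $\mathcal{D}^{<\mu}$-filtered modules, where $\mathcal{D}^{<\mu}$ is the class of all $<\mu$-presented modules in $\mathcal{D}$. An embedding is a monomorphism. A submodule $N$ of $M$ is an RD-submodule if $N\cap Mr=Nr$ for all $r\in R$; it is a pure submodule if every finite system of $R$-linear equations with right-hand side in $N$ that is solvable in $M$ is solvable in $N$. An RD-embedding (pure embedding) is a monomorphism whose image is an RD-submodule (pure submodule) of its codomain. For $A,B\in\mathcal{D}$, $A\leq_{\mathcal{M}}B$ means that $A$ is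 a submodule of $B$ and the inclusion is in $\mathcal{M}$. A $\mathbf{D}$-embedding is a monomorphism $f:A\to B$ with $A,B\in\mathcal{D}$ and $f(A)\leq_{\mathcal{M}}B$. $\mathbf{D}$ has the amalgamation property if for every infinite cardinal $\lambda$ and all $\mathbf{D}$-embeddings $f_1:A_0\to A_1$, $f_2:A_0\to A_2$ with $\aleph_0\leq\|A_i\|\leq\lambda$ ($i=0,1,2$), there are $A_3\in\mathcal{D}$ with $\aleph_0\leq\|A_3\|\leq\lambda$ and $\mathbf{D}$-embeddings $g_1:A_1\to A_3$, $g_2:A_2\to A_3$ with $g_1f_1=g_2f_2$. Galois types: consider triples $(\bar b,A,N)$ with $N\in\mathcal{D}$, $A$ a submodule of $N$, and $\bar b$ a (possibly infinite) tuple of elements of $N$. Triples $(\bar b_1,A_1,N_1),(\bar b_2,A_2,N_2)$ are atomically related if $A_1=A_2=:A$ and there are $N\in\mathcal{D}$ and $\mathbf{D}$-embeddings $f_i:N_i\to N$ ($i=1,2$) restricting to the identity on $A$ with $f_1(\bar b_1)=f_2(\bar b_2)$. Let $E^{\mathbf{D}}$ be the transitive closure of this relation; $\mathbf{gtp}_{\mathbf{D}}(\bar b/A;N)$ is the $E^{\mathbf{D}}$-class of $(\bar b,A,N)$. For $p=\mathbf{gtp}_{\mathbf{D}}(\bar b/M;N)$ and $M_0$ a submodule of $M$, $p\upharpoonright M_0=\mathbf{gtp}_{\mathbf{D}}(\bar b/M_0;N)$. For $M\in\mathcal{D}$, $\mathbf{gS}_{\mathbf{D}}(M)=\{\mathbf{gtp}_{\mathbf{D}}(b/M;N)\mid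 M\leq_{\mathcal{M}}N\in\mathcal{D},\ b\in N\text{ a single element}\}$. $\mathbf{D}$ is $\kappa$-tame if for every $A\in\mathcal{D}$ and $p,q\in\mathbf{gS}_{\mathbf{D}}(A)$ with $p\neq q$ there is $B\leq_{\mathcal{M}}A$ (so $B\in\mathcal{D}$) with $\|B\|\leq\kappa$ and $p\upharpoonright B\neq q\upharpoonright B$. (The definition is made for $\kappa\geq\operatorname{LS}(\mathbf{D})$, where $\operatorname{LS}(\mathbf{D})$ is the least infinite cardinal $\lambda\geq\operatorname{card}(R)$ such that every submodule $A$ of a $B\in\mathcal{D}$ is contained in some $A'\leq_{\mathcal{M}}B$ with $A'\in\mathcal{D}$ and $\|A'\|\leq\|A\|+\lambda$.) *)

(* Defs.v *)
From HB Require Import structures.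
From mathcomp Require Import all_boot all_order all_algebra.
From mathcomp Require Import ring_quotient.
From mathcomp Require Import boolp classical_sets functions cardinality wochoice.
From Stdlib Require Import Relation_Operators.

Set Implicit Arguments.
Unset Strict Implicit.
Unset Printing Implicit Defensive.

Import GRing.Theory.
Local Open Scope classical_set_scope.
Local Open Scope card_scope.
Local Open Scope ring_scope.

(* A cardinal is given by any type of that cardinality; two types stand for the
   same cardinal when they are equipotent. *)
Definition cardinal := Type.

Definition cle (a b : cardinal) : Prop := [set: a] #<= [set: b].
Definition clt (a b : cardinal) : Prop := cle a b /\ ~ cle b a.
Definition cinfinite (a : cardinal) : Prop := cle nat a.

(* b = a^+, the least cardinal greater than a *)
Definition succ_cardinal (a b : cardinal) : Prop :=
  clt a b /\ forall c : cardinal, clt a c -> cle b c.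

(* Right R-modules are left modules over the converse ring R^c, so x r is
   written r *: x.  The constant is the ring instance of R^c. *)
Notation rmodType R := (lmodType (GRing.GRing_converse__canonical__GRing_PzRing R)).

Definition mcard (R : pzRingType) (M : rmodType R) : cardinal := M.

Definition miso (R : pzRingType) (A B : rmodType R) : Prop :=
  exists f : {linear A -> B}, bijective f.

(* Submodules of M are the library's [submodClosed M], i.e. boolean predicates
   closed under the module operations; classically these are arbitrary
   submodules. *)
Section Submodule.
Context (R : pzRingType) (M : rmodType R) (S : submodClosed M).

Definition submod : Type := {x : M | x \in S}.
HB.instance Definition _ := SubChoice.on submod.
HB.instance Definition _ := [SubChoice_isSubLmodule of submod by <:].

Definition submod_incl : {linear submod -> M} := (val : submod -> M).

Definition submod_zpred : {pred M} := S.

Lemma submod_zpred_closed : zmod_closed submod_zpred.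
Proof. exact: GRing.submod_closedB (submodClosedP S). Qed.

HB.instance Definition _ :=
  GRing.isZmodClosed.Build M submod_zpred submod_zpred_closed.

End Submodule.

Section QuotientModule.
Context (R : pzRingType) (M : rmodType R) (S : submodClosed M).
Local Open Scope quotient_scope.

Definition qmod : Type := Quotient.quot (submod_zpred S).
HB.instance Definition _ := GRing.Zmodule.on qmod.
HB.instance Definition _ := EqQuotient.on qmod.

Definition qpi (x : M) : qmod := \pi x.

Lemma qpiP (P : qmod -> Prop) : (forall x, P (qpi x)) -> forall q, P q.
Proof. by move=> h q; rewrite -[q]reprK; exact: h. Qed.

Definition qscale (r : R^c) (x : qmod) : qmod := qpi (r *: repr x).

Lemma qmodE (x y : M) : (x - y \in S) = (qpi x == qpi y).
Proof. exact: (@Quotient.idealrBE M (submod_zpred S)). Qed.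

Lemma qmodD (x y : M) : qpi (x + y) = qpi x + qpi y.
Proof. exact: (@Quotient.pi_add M (submod_zpred S)). Qed.

Lemma qscaleE r x : qscale r (qpi x) = qpi (r *: x).
Proof.
apply/eqP; rewrite -qmodE -scalerBr; apply: rpredZ.
by rewrite qmodE /qpi reprK eqxx.
Qed.

Lemma qscaleA a b v : qscale a (qscale b v) = qscale (a * b) v.
Proof. by elim/qpiP: v => v; rewrite !qscaleE scalerA. Qed.

Lemma qscale1 : left_id 1 qscale.
Proof. by elim/qpiP=> v; rewrite qscaleE scale1r. Qed.

Lemma qscaleDr : right_distributive qscale +%R.
Proof.
by move=> a; elim/qpiP=> u; elim/qpiP=> v; rewrite -qmodD !qscaleE scalerDr qmodD.
Qed.

Lemma qscaleDl v : {morph qscale^~ v : a b / a + b}.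
Proof. by elim/qpiP: v => v a b; rewrite !qscaleE scalerDl qmodD. Qed.

HB.instance Definition _ := GRing.Zmodule_isLmodule.Build R^c qmod
  qscaleA qscale1 qscaleDr qscaleDl.

End QuotientModule.

Section Submodules.
Context (R : pzRingType).
Implicit Types A B M : rmodType R.

Section Image.
Context (A B : rmodType R) (f : {linear A -> B}).
Definition img_pred : {pred B} := fun y => `[< exists x, f x = y >].
Lemma img_pred_closed : submod_closed img_pred.
Proof.
split; first by apply/asboolP; exists 0; rewrite linear0.
move=> a _ _ /asboolP[x <-] /asboolP[y <-]; apply/asboolP.
by exists (a *: x + y); rewrite linearP.
Qed.
HB.instance Definition _ :=
  GRing.isSubmodClosed.Build R^c B img_pred img_pred_closed.
Definition img : submodClosed B := img_pred.
End Image.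

Section Span.
Context (M : rmodType R) (Y : set M).
Definition span_pred : {pred M} :=
  fun x => `[< forall S : submodClosed M, Y `<=` [set` S] -> x \in S >].
Lemma span_pred_closed : submod_closed span_pred.
Proof.
split; first by apply/asboolP => S _; exact: rpred0.
move=> a x y /asboolP hx /asboolP hy; apply/asboolP => S YS.
by rewrite rpredD ?rpredZ ?hx ?hy.
Qed.
HB.instance Definition _ :=
  GRing.isSubmodClosed.Build R^c M span_pred span_pred_closed.
Definition span : submodClosed M := span_pred.
End Span.

(* N `&` S as a submodule of (the module) S *)
Section Relative.
Context (M : rmodType R) (N S : submodClosed M).
Definition rel_pred : {pred submod S} := fun x => val x \in N.
Lemma rel_pred_closed : submod_closed rel_pred.
Proof.
split; first by rewrite unfold_in raddf0 rpred0.
by move=> a x y hx hy; rewrite unfold_in linearP rpredD ?rpredZ.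
Qed.
HB.instance Definition _ :=
  GRing.isSubmodClosed.Build R^c (submod S) rel_pred rel_pred_closed.
Definition relsub : submodClosed (submod S) := rel_pred.
End Relative.

(* the free right module R^(X): finitely supported functions X -> R *)
Section Free.
Context (X : Type).
Definition fsupp_pred : {pred (X -> (R^c)^o)} :=
  fun c => `[< finite_set [set x | c x != 0] >].
Lemma fsupp_pred_closed : submod_closed fsupp_pred.
Proof.
split.
  apply/asboolP; suff -> : [set x : X | (0 : X -> (R^c)^o) x != 0] = set0 by [].
  by apply/seteqP; split=> x //=; rewrite eqxx.
move=> a c d /asboolP hc /asboolP hd; apply/asboolP.
apply: (@sub_finite_set _ _ ([set x | c x != 0] `|` [set x | d x != 0])).
  move=> x /= h; apply: contrapT => /not_orP[/negP/negPn/eqP c0 /negP/negPn/eqP d0].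
  have e : (a *: c + d) x = a *: c x + d x by [].
  by move: h; rewrite e c0 d0 scaler0 addr0 eqxx.
by rewrite finite_setU.
Qed.
HB.instance Definition _ :=
  GRing.isSubmodClosed.Build R^c (X -> (R^c)^o) fsupp_pred fsupp_pred_closed.
Definition free_mod : rmodType R := submod (fsupp_pred : submodClosed _).
End Free.

End Submodules.

Section Classes.
Context (R : pzRingType).

Definition mod_class := rmodType R -> Prop.

(* M = R^(X) / <Y> with fewer than mu generators X and fewer than mu
   relations Y *)
Definition lt_presented (mu : cardinal) (M : rmodType R) : Prop :=
  exists (X : cardinal) (Y : set (free_mod R X)),
    [/\ clt X mu, clt (set_type Y) mu & miso (qmod (span Y)) M].

(* The indices i <= delta are the elements of a well-ordered set with a greatest
   element [top]. *)
Definition filtered (C : mod_class) (M : rmodType R) : Prop :=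
  exists (I : eqType) (le : rel I) (top : I) (F : I -> submodClosed M),
    let lt i j := le i j && (i != j) in
    let is_bot i := forall j, le i j in
    let is_succ i j := lt i j /\ forall k, lt i k -> le j k in
    let is_limit i := ~ is_bot i /\ ~ exists j, is_succ j i in
    [/\ well_order le /\ (forall i, le i top),
        forall i j, le i j -> [set` F i] `<=` [set` F j],
        (forall i, is_bot i -> [set` F i] = [set 0])
          /\ [set` F top] = [set: M],
        forall i, is_limit i -> [set` F i] = \bigcup_(j in [set j | lt j i]) [set` F j]
      & forall i j, is_succ i j ->
          exists2 N, C N & miso (qmod (relsub (F i) (F j))) N].

Definition deconstructible (mu : cardinal) (D : mod_class) : Prop :=
  forall M, D M <-> filtered (fun N => D N /\ lt_presented mu N) M.

Definition RD_submod (M : rmodType R) (N : submodClosed M) : Prop :=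
  forall r : R^c,
    [set` N] `&` range (fun x : M => r *: x) = (fun x : M => r *: x) @` [set` N].

Definition pure_submod (M : rmodType R) (N : submodClosed M) : Prop :=
  forall (m n : nat) (a : 'I_m -> 'I_n -> R^c) (b : 'I_m -> M),
    (forall i, b i \in N) ->
    (exists x : 'I_n -> M, forall i, \sum_(j < n) a i j *: x j = b i) ->
    exists2 x : 'I_n -> M, forall j, x j \in N
      & forall i, \sum_(j < n) a i j *: x j = b i.

Definition mor_class := forall A B : rmodType R, {linear A -> B} -> Prop.

Definition embedding : mor_class := fun A B f => injective f.
Definition RD_embedding : mor_class :=
  fun A B f => injective f /\ RD_submod (img f).
Definition pure_embedding : mor_class :=
  fun A B f => injective f /\ pure_submod (img f).

End Classes.

Section ClassWithEmbeddings.
Context (R : pzRingType) (D : mod_class R) (E : mor_class R).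

(* S <=_E B *)
Definition leE (B : rmodType R) (S : submodClosed B) : Prop :=
  [/\ D (submod S), D B & E (submod_incl S)].

Definition D_embedding (A B : rmodType R) (f : {linear A -> B}) : Prop :=
  [/\ D A, D B, injective f & leE (img f)].

Definition amalgamation : Prop :=
  forall lambda : cardinal, cinfinite lambda ->
  forall (A0 A1 A2 : rmodType R) (f1 : {linear A0 -> A1}) (f2 : {linear A0 -> A2}),
    D_embedding f1 -> D_embedding f2 ->
    (cinfinite (mcard A0) /\ cle (mcard A0) lambda) ->
    (cinfinite (mcard A1) /\ cle (mcard A1) lambda) ->
    (cinfinite (mcard A2) /\ cle (mcard A2) lambda) ->
    exists (A3 : rmodType R) (g1 : {linear A1 -> A3}) (g2 : {linear A2 -> A3}),
      [/\ D A3, cinfinite (mcard A3) /\ cle (mcard A3) lambda,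
          D_embedding g1, D_embedding g2 & g1 \o f1 =1 g2 \o f2].

(* A triple (b, A, N) with b indexed by I.  As distinct modules cannot share a
   submodule on the nose, "A is a submodule of N" is an injective linear map
   A -> N, to be thought of as the inclusion; a map f : N1 -> N2 restricts to
   the identity on A when it commutes with the two inclusions. *)
Record triple (A : rmodType R) (I : Type) := Triple {
  tmod : rmodType R;
  tmod_in : D tmod;
  tincl : {linear A -> tmod};
  tincl_inj : injective tincl;
  ttup : I -> tmod
}.

Definition atomic (A : rmodType R) (I : Type) (t1 t2 : triple A I) : Prop :=
  exists (N : rmodType R) (f1 : {linear tmod t1 -> N}) (f2 : {linear tmod t2 -> N}),
    [/\ D_embedding f1, D_embedding f2,
        f1 \o tincl t1 =1 f2 \o tincl t2 & f1 \o ttup t1 =1 f2 \o ttup t2].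

(* Classes of triples, as predicates: triples are too large for [set]. *)
Definition gtype (A : rmodType R) (I : Type) := triple A I -> Prop.

Definition gtp (A : rmodType R) (I : Type) (t : triple A I) : gtype A I :=
  fun t' => clos_trans _ (@atomic A I) t t'.

Definition triple_restr (A : rmodType R) (I : Type) (t : triple A I)
    (B : submodClosed A) : triple (submod B) I :=
  @Triple (submod B) I (tmod t) (tmod_in t) (tincl t \o submod_incl B)
    (inj_comp (@tincl_inj _ _ t) val_inj) (@ttup _ _ t).

(* Independent of the representative t of p, see [gtp_restrE]. *)
Definition gtp_restr (A : rmodType R) (I : Type) (p : gtype A I)
    (B : submodClosed A) : gtype (submod B) I :=
  fun s => exists2 t, p t & gtp (triple_restr t B) s.
Arguments gtp_restr {A I} p B _.

(* types of single elements: tuples indexed by [unit] *)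
Definition gS (A : rmodType R) (p : gtype A unit) : Prop :=
  exists2 t : triple A unit, D_embedding (tincl t) & p = gtp t.

Definition tame (kappa : cardinal) : Prop :=
  forall A : rmodType R, D A ->
  forall p q : gtype A unit, gS p -> gS q -> p <> q ->
  exists B : submodClosed A,
    [/\ leE B, cle (mcard (submod B)) kappa & gtp_restr p B <> gtp_restr q B].

Lemma gtp_restrE (A : rmodType R) (I : Type) (t : triple A I) (B : submodClosed A) :
  atomic t t -> gtp_restr (gtp t) B = gtp (triple_restr t B).
Proof.
move=> tt; apply/funext => s; apply/propext.
split=> [[t' tt' t's]|ts]; last by exists t => //; left.
apply: (t_trans _ _ _ _ _ _ t's).
elim: tt' {tt t's} => {t'} [u v [N [f1 [f2 [h1 h2 h3 h4]]]]|u v w _ + _]; last exact: t_trans.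
by left; exists N, f1, f2; split=> // x; exact: (h3 (val x)).
Qed.

End ClassWithEmbeddings.

(* Main.v *)
From HB Require Import structures.
From mathcomp Require Import all_boot all_order all_algebra.
From mathcomp Require Import boolp classical_sets functions cardinality wochoice.
From Stdlib Require Import Relation_Operators.
Require Import Defs.

Set Implicit Arguments.
Unset Strict Implicit.
Unset Printing Implicit Defensive.

Import GRing.Theory.
Local Open Scope classical_set_scope.
Local Open Scope card_scope.
Local Open Scope ring_scope.

(** The idea is that a type over [A] is determined by its restriction to one
well-chosen small submodule [B] of [A].

Let the types be realised by [b1] in an extension [N1] of [A] and by [b2] in [N2].
Each of [A], [N1], [N2] is in the class, hence has a filtration whose factors are
modules of the class with at most [kappa] elements ([cle_presented]).  A Skolem hull
argument ([common_hull]) gives submodules [B], [S1], [S2] of [A], [N1], [N2] with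
[b1] in [S1], [b2] in [S2] and [B] of cardinality at most [kappa], such that [S1] and
[S2] both meet [A] in [B], such that all three are adapted to the filtrations, and
such that they are pure and moreover [S1] and [S2] are pure modulo [A].  Being adapted
means meeting each factor of the filtration in [0] or in everything; it replaces the
Hill lemma.  It gives that the submodule is in the class ([adapted_filtered]) and that
a module obtained from a module of the class by gluing [A] on along [B] is again in
the class ([glue_filtered]), because [A / B] is filtered.

Assume that the restrictions of the types to [B] agree.  By amalgamation there is an
amalgam [U] of [N1] and [N2] over [B] in which [b1] and [b2] have the same image
([gtp_eqP]).  In [U] the two images of [A] may differ, so [U] is replaced by the
pushout [P] of [U] and [A] over [B], which is in the class by gluing.  The submodule
[S1 + A] of [N1] is the pushout of [S1] and [A] over [B], and therefore embeds in [P];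
it is in the class, again by gluing, and it is an admissible submodule of [N1], since
[A] is one and [S1] is pure modulo [A] ([spure_add]).  So [N1] and [P] can be
amalgamated over [S1 + A], and likewise [N2] and [P] over [S2 + A]
([amalgamate_pushout]).  Amalgamating the two results over [P] gives an extension in
which the copies of [A] coincide and [b1] and [b2] are identified: the types are
equal.

Embeddings, RD-embeddings and pure embeddings are treated at once, as the
monomorphisms whose image reflects solvability of the systems of equations of certain
shapes ([embedding_shape]).  That at most [kappa] many Skolem terms occur is the
equation [kappa * kappa = kappa] ([cle_square]). *)

(** * Cardinal arithmetic *)

Lemma cleP (a b : cardinal) : cle a b <-> exists f : a -> b, injective f.
Proof.
split=> [/card_leP[f]|[f fI]].
  exists (val \o f \o @to_setT a) => x y /= /val_inj/inj.
  by move=> /(_ (mem_set Logic.I) (mem_set Logic.I)) [].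
apply: card_le_trans (card_leT (range f)).
by case/card_eqPle: (inj_card_eq (in2W fI : {in [set: a] &, injective f})).
Qed.

Lemma sval_inj (T : Type) (P : T -> Prop) : injective (@sval T P).
Proof. by move=> [x Px] [y Py] /= xy; exact: eq_exist. Qed.

Lemma cle_inj (a b : cardinal) (f : a -> b) : injective f -> cle a b.
Proof. by move=> fI; apply/cleP; exists f. Qed.

Lemma cle_refl (a : cardinal) : cle a a.
Proof. exact: card_lexx. Qed.

Lemma cle_trans (b a c : cardinal) : cle a b -> cle b c -> cle a c.
Proof. exact: card_le_trans. Qed.

Lemma cle_prod (a b a' b' : cardinal) :
  cle a a' -> cle b b' -> cle (a * b)%type (a' * b')%type.
Proof.
move=> /cleP[f fI] /cleP[g gI]; apply: (cle_inj (f := fun x => (f x.1, g x.2))).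
by move=> [x1 x2] [y1 y2] [/fI -> /gI ->].
Qed.

Lemma cle_sum (a b a' b' : cardinal) :
  cle a a' -> cle b b' -> cle (a + b)%type (a' + b')%type.
Proof.
move=> /cleP[f fI] /cleP[g gI].
apply: (cle_inj (f := fun x => match x with inl u => inl (f u) | inr v => inr (g v) end)).
by move=> [x|x] [y|y] // [] => [/fI|/gI] ->.
Qed.

(** A sum embeds into the square as soon as two elements are available to tag
the summands. *)
Lemma cle_double (a : cardinal) (x y : a) : x <> y -> cle (a + a)%type (a * a)%type.
Proof.
move=> xy; apply: (cle_inj (f := fun u => match u with inl u => (x, u) | inr u => (y, u) end)).
by move=> [u|u] [v|v] [] => [->|/xy[]|/esym/xy[]|->].
Qed.

Lemma cle_surj (a b : cardinal) (f : a -> b) : (forall y, exists x, f x = y) -> cle b a.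
Proof. by move=> /choice[g fg]; apply: (cle_inj (can_inj fg)). Qed.

(** Any two cardinals are comparable: a maximal graph of a partial bijection is
total on one of the two sides. *)
Lemma cle_total (a b : cardinal) : cle a b \/ cle b a.
Proof.
pose P := [set G : set (a * b) | forall p q, G p -> G q -> p.1 = q.1 <-> p.2 = q.2].
have [F FP Ftot|G [GP Gmax]] := @Zorn_bigcup _ P.
  move=> p q [G FG Gp] [H FH Hq].
  by case: (Ftot _ _ FG FH) => s; [apply: (FP _ FH)|apply: (FP _ FG)] => //; exact: s.
have [ta|/existsNP[x xG]] := pselect (forall x, exists y, G (x, y)).
  left; have [f fG] := choice ta; apply: (cle_inj (f := f)) => x y fxy.
  by apply/(GP _ _ (fG x) (fG y)).
have [tb|/existsNP[y yG]] := pselect (forall y, exists x, G (x, y)).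
  right; have [f fG] := choice tb; apply: (cle_inj (f := f)) => u v fuv.
  by apply/(GP _ _ (fG u) (fG v)).
case: (Gmax (G `|` [set (x, y)])).
  split=> [p Gp|s]; first by left.
  by apply: xG; exists y; apply: s; right.
move=> [p1 p2] [q1 q2] /= [Gp|[-> ->]] [Gq|[-> ->]] //; first exact: GP Gp Gq.
  by split=> e; [case: xG|case: yG]; [exists p2|exists p1]; rewrite -e.
by split=> e; [case: xG|case: yG]; [exists q2|exists q1]; rewrite e.
Qed.

(** The square of an infinite cardinal [k] is [k].  A maximal injection of a
square [X * X] into [X] with [X] infinite has [k <= X]: otherwise the complement
of [X] contains a disjoint copy of [X], large enough to receive the pairs that
are not in [X * X]. *)
Lemma cle_square (k : cardinal) : cinfinite k -> cle (k * k)%type k.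
Proof.
move=> /cleP[n nI].
(* graphs of injections X * X -> X, where X is the set of all u such that (u, u)
   has an image *)
pose dom (G : set (k * k * k)) u := exists z, G (u, u, z).
pose good (G : set (k * k * k)) :=
  [/\ forall p q, G p -> G q -> p.1 = q.1 <-> p.2 = q.2,
      forall u v z, G (u, v, z) -> [/\ dom G u, dom G v & dom G z]
    & forall u v, dom G u -> dom G v -> exists z, G (u, v, z)].
pose G0 : set (k * k * k) :=
  [set p | exists i j, p = (n i, n j, n (pickle (i, j)))].
have G0n i : dom G0 (n i) by exists (n (pickle (i, i))); exists i, i.
have good0 : good G0.
  split=> [p q [i [j ->]] [i' [j' ->]] /=|u v z [i [j [-> -> ->]]]|u v].
  - split=> [[/nI -> /nI ->] //|/nI/(pcan_inj pickleK)[-> ->] //].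
  - by split.
  - by move=> [? [i [_ [-> _ _]]]] [? [j [_ [-> _ _]]]]; exists (n (pickle (i, j))); exists i, j.
(* adding G0 keeps X infinite and admits the union of the empty chain *)
have [F FP Ftot|G' [GP Gmax]] := @Zorn_bigcup _ [set G | good (G `|` G0)].
  have [[H0 FH0]|F0] := pselect (exists H, F H); last first.
    by rewrite /= (_ : bigcup _ _ = set0) ?set0U // -subset0 => p [H FH _]; apply: F0; exists H.
  have sub H : F H -> H `|` G0 `<=` \bigcup_(X in F) X `|` G0.
    by move=> FH p [Hp|G0p]; [left; exists H|right].
  have ex p : (\bigcup_(X in F) X `|` G0) p -> exists2 H, F H & (H `|` G0) p.
    by move=> [[H FH Hp]|G0p]; [exists H => //; left|exists H0 => //; right].
  have ex2 p q : (\bigcup_(X in F) X `|` G0) p -> (\bigcup_(X in F) X `|` G0) q ->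
      exists2 H, F H & (H `|` G0) p /\ (H `|` G0) q.
    move=> /ex[H FH Hp] /ex[H' FH' Hq]; have [s|s] := Ftot _ _ FH FH'.
      by exists H' => //; split=> //; case: Hp => [/s|]; [left|right].
    by exists H => //; split=> //; case: Hq => [/s|]; [left|right].
  split=> [p q hp hq|u v z /ex[H FH Hp]|u v [z hz] [t ht]].
  - by have [H FH [Hp Hq]] := ex2 _ _ hp hq; case: (FP _ FH) => h _ _; exact: h.
  - case: (FP _ FH) => _ /(_ _ _ _ Hp)[[x hx] [y hy] [t ht]] _.
    by split; [exists x|exists y|exists t]; exact: (sub _ FH).
  - have [H FH [Hz Ht]] := ex2 _ _ hz ht; case: (FP _ FH) => _ _ h.
    have [||w hw] := h u v; [by exists z|by exists t|].
    by exists w; exact: (sub _ FH).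
set G := G' `|` G0 in GP; case: GP => G1 G2 G3.
pose X := {u | dom G u}.
have [p pG] : exists p : X -> X -> X, forall u v, G (sval u, sval v, sval (p u v)).
  have /choice[p pG] : forall uv : X * X, exists z : X, G (sval uv.1, sval uv.2, sval z).
    move=> [[u hu] [v hv]] /=; have [z hz] := G3 _ _ hu hv.
    by have [_ _ dz] := G2 _ _ _ hz; exists (exist _ z dz).
  by exists (fun u v => p (u, v)) => u v; exact: (pG (u, v)).
have pI u v u' v' : p u v = p u' v' -> u = u' /\ v = v'.
  move=> e; have /(_ (congr1 sval e))[e1 e2] := (G1 _ _ (pG u v) (pG u' v')).2.
  by split; apply: sval_inj.
have x_ i : dom G (n i) by have [z hz] := G0n i; exists z; right.
pose c i : X := exist _ (n i) (x_ i).
have c01 : c 0%N <> c 1%N by move=> /(congr1 sval)/nI.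
have XX : cle (X * X)%type X.
  by apply: (cle_inj (f := fun u => p u.1 u.2)) => -[u v] [u' v'] /= /pI[-> ->].
have [kX|Xk] := cle_total {u : k | ~ dom G u} X.
  have kX' : cle k X.
    apply: cle_trans XX; apply: cle_trans (cle_double c01).
    apply: cle_trans (cle_sum kX (cle_refl X)).
    pose f (u : k) : {u : k | ~ dom G u} + X := match pselect (dom G u) with
      left h => inr (exist _ u h) | right h => inl (exist _ u h) end.
    apply: (cle_inj (f := f)) => u v; rewrite /f.
    by case: pselect => ?; case: pselect => ? [].
  apply: cle_trans (cle_prod kX' kX') _; apply: cle_trans XX _.
  by apply: (cle_inj (f := sval)) => u v; exact: sval_inj.
exfalso; move/cleP: Xk => [g gI].
(* [e] places two disjoint copies of X, namely X itself and g X, in k; [cd] codes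
   the points of both copies by points of X *)
pose e (w : bool * X) : k := if w.1 then sval w.2 else sval (g w.2).
have eI : injective e.
  move=> [[] u] [[] v]; rewrite /e /= => h.
  - by congr pair; exact: sval_inj.
  - by case: (svalP (g v)); rewrite -h; exact: svalP.
  - by case: (svalP (g u)); rewrite h; exact: svalP.
  - by congr pair; apply: gI; exact: sval_inj.
pose cd (w : bool * X) : X := p (if w.1 then c 0%N else c 1%N) w.2.
have cdI : injective cd by move=> [[] u] [[] v] /pI[] /= => [_|/c01[]|/esym/c01[]|_] ->.
pose ext : set (k * k * k) := [set q | exists w w' : bool * X,
  ~~ (w.1 && w'.1) /\ q = (e w, e w', e (false, p (cd w) (cd w')))].
have GU q : G q -> exists u v : X, q = (e (true, u), e (true, v), e (true, p u v)).
  case: q => [[u v] z] hz; have [du dv dz] := G2 _ _ _ hz.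
  exists (exist _ u du), (exist _ v dv); rewrite /e /=; congr pair.
  by apply/(G1 _ _ hz (pG (exist _ u du) (exist _ v dv))).
have dome w : dom (G `|` ext) (e w).
  case: w => -[] u; last first.
    exists (e (false, p (cd (false, u)) (cd (false, u)))); right.
    by exists (false, u), (false, u).
  by exists (sval (p u u)); left; exact: pG.
have edom u : dom (G `|` ext) u -> exists w, u = e w.
  by move=> [z [/GU[v [_ [-> _ _]]]|[w [_ [_ [-> _ _]]]]]]; [exists (true, v)|exists w].
case: (Gmax (G `|` ext)).
  split=> [q qG|s]; first by left; left.
  pose w := (false, c 0%N); pose q := (e w, e w, e (false, p (cd w) (cd w))).
  have q1 : ext q by exists w, w.
  have /GU[u [v [/eI//]]] : G q by left; apply: s; right.
rewrite /= (_ : _ `|` G0 = G `|` ext); last first.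
  by apply/seteqP; split=> q h; [case: h => // h; left; right|left].
split=> [q r|u v z|u v /edom[w ->] /edom[w' ->]].
- case=> [/GU[u [v ->]]|[[s u] [[t v] [st ->]]]] [/GU[u' [v' ->]]|[[s' u'] [[t' v'] [st' ->]]]] /=.
  + split=> [[/eI[->] /eI[->] //]|/eI[/pI[-> ->]] //].
  + by split=> [[/eI[es _] /eI[et _]]|/eI[]//]; move: st'; rewrite -es -et.
  + by split=> [[/eI[es _] /eI[et _]]|/eI[]//]; move: st; rewrite es et.
  + by split=> [[/eI-> /eI->]|/eI[/pI[/cdI -> /cdI ->]]].
- by case=> [/GU[u' [v' [-> -> ->]]]|[w [w' [_ [-> -> ->]]]]]; split; exact: dome.
- case: w => s u'; case: w' => t v'; case: (boolP (s && t)) => [/andP[-> ->]|st].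
    by exists (sval (p u' v')); left; exact: pG.
  by exists (e (false, p (cd (s, u')) (cd (t, v')))); right; exists (s, u'), (t, v').
Qed.

(** Lists are coded by their length and an iterated pairing. *)
Lemma cle_seq (k : cardinal) : cinfinite k -> cle (seq k) k.
Proof.
move=> kinf; have kk := cle_square kinf; have /cleP[p pI] := kk; have /cleP[n _] := kinf.
pose f := fix f (s : seq k) := if s is x :: s' then p (x, f s') else n 0%N.
apply: cle_trans kk; apply: cle_trans (cle_prod kinf (cle_refl k)).
apply: (cle_inj (f := fun s => (size s, f s))).
elim=> [|x s IH] [|y t] //= [] st /pI[-> fst]; congr cons.
by apply: IH; rewrite st fst.
Qed.

Lemma cle_tree (k : cardinal) : cinfinite k -> cle (GenTree.tree k) k.
Proof.
move=> kinf; apply: cle_trans (cle_seq kinf).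
apply: (@cle_trans (seq (nat + k))).
  exact: cle_inj (pcan_inj (GenTree.codeK k)).
have /cleP[f fI] : cle (nat + k)%type k.
  apply: cle_trans (cle_square kinf); apply: cle_trans (cle_sum kinf (cle_refl k)) _.
  have /cleP[n nI] := kinf; apply: (@cle_double _ (n 0%N) (n 1%N)).
  by move/nI.
exact: cle_inj (inj_map fI).
Qed.

Lemma clt_succ (k s x : cardinal) : succ_cardinal k s -> clt x s <-> cle x k.
Proof.
move=> [[ks nks] smin]; split=> [[xs nsx]|xk]; last first.
  split; first exact: cle_trans ks.
  by move=> sx; apply: nks; exact: cle_trans xk.
have [//|kx] := cle_total x k.
by apply: contrapT => nxk; apply: nsx; apply: smin.
Qed.

(** * Skolem hulls *)

(** A rule asks, for a label [l] and a finite tuple [s] of inputs, for a finite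
tuple of outputs. *)
Definition rule (L T : Type) :=
  L -> forall m, ('I_m -> T) -> forall n, ('I_n -> T) -> Prop.

Definition closed_under L T (S : set T) (Q : rule L T) :=
  forall l m s, (forall i, S (s i)) -> (exists n y, Q l m s n y) ->
  exists n y, (forall j, S (y j)) /\ Q l m s n y.

(** Trees whose nodes carry a label and an output index are terms for a choice of
Skolem functions, so their values form a closed set. *)
Lemma skolem_hull L T (t0 : T) (Q : rule L T) :
  exists ev : GenTree.tree L -> T, closed_under (range ev) Q.
Proof.
have /choice[Phi PhiQ] : forall ls : L * {m & 'I_m -> T}, exists y : {n & 'I_n -> T},
    (exists n y, Q ls.1 (tag ls.2) (tagged ls.2) n y) ->
    Q ls.1 (tag ls.2) (tagged ls.2) (tag y) (tagged y).
  move=> ls; have [[n [y Qy]]|nQ] := pselect (exists n y, Q ls.1 (tag ls.2) (tagged ls.2) n y).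
    by exists (Tagged (fun n => 'I_n -> T) y).
  by exists (existT _ 0%N (fun _ => t0)).
pose pick (y : {n & 'I_n -> T}) i := if insub i is Some j then tagged y j else t0.
pose ev := fix ev (t : GenTree.tree L) : T := match t with
  | GenTree.Node i (GenTree.Leaf l :: ts) =>
      pick (Phi (l, existT (fun m => 'I_m -> T) (size (map ev ts))
                           (fun j => nth t0 (map ev ts) j))) i
  | _ => t0 end.
exists ev => l m s /(_ _)/cid2-/all_sig2[t _ ts] Qex.
pose tt := [seq t i | i <- enum 'I_m].
have e : existT (fun m => 'I_m -> T) (size (map ev tt)) (fun j => nth t0 (map ev tt) j) =
    existT _ m s.
  have sz : size (map ev tt) = m by rewrite size_map /tt size_map size_enum_ord.
  have nt (i : 'I_m) : nth t0 (map ev tt) i = s i.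
    by rewrite /tt -map_comp (nth_map i) ?size_enum_ord //= nth_ord_enum ts.
  move: (map ev tt) sz nt => w sz; case: m / sz s {t ts Qex tt} => s nt.
  by congr existT; apply/funext => j; exact: nt.
exists (tag (Phi (l, existT _ m s))), (tagged (Phi (l, existT _ m s))).
split; last exact: (PhiQ (l, existT _ m s)).
move=> j; exists (GenTree.Node j (GenTree.Leaf l :: tt)) => //=.
by rewrite -/tt e /pick valK.
Qed.

(** The properties of a subset that a Skolem hull with at most [k] labels can be
made to have. *)
Definition finitary (k T : Type) (P : set T -> Prop) :=
  exists Q : rule k T, forall S, closed_under S Q -> P S.

Section Finitary.
Context (k : Type) (kinf : cinfinite k).

(** Rules may be labelled by any set of at most [k] elements. *)
Lemma finitary_rule L T (Q : rule L T) :
  cle L k -> finitary k (fun S => closed_under S Q).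
Proof.
move=> /cleP[g gI].
exists (fun l m s n y => exists2 l', l = g l' & Q l' m s n y) => S SQ l m s Ss [n [y Qy]].
have [|n' [y' [Sy' [l' /gI <- Q']]]] := SQ (g l) m s Ss; first by exists n, y, l.
by exists n', y'.
Qed.

Lemma finitary_sub T (P P' : set T -> Prop) :
  (forall S, P S -> P' S) -> finitary k P -> finitary k P'.
Proof. by move=> PP' [Q QP]; exists Q => S /QP/PP'. Qed.

(** The two rules are merged by tagging their labels, which costs nothing since
[k + k <= k]. *)
Lemma finitary_and T (P P' : set T -> Prop) :
  finitary k P -> finitary k P' -> finitary k (fun S => P S /\ P' S).
Proof.
move=> [Q QP] [Q' QP'].
have : finitary k (fun S => closed_under S
    (fun l : k + k => match l with inl l => Q l | inr l => Q' l end)).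
  apply: finitary_rule; apply: cle_trans (cle_square kinf).
  have /cleP[n nI] := kinf; apply: (@cle_double _ (n 0%N) (n 1%N)).
  by move/nI.
apply: finitary_sub => S SQ; split; [apply: QP => l|apply: QP' => l].
  exact: (SQ (inl l)).
exact: (SQ (inr l)).
Qed.

Lemma finitary_preimage M T (e : M -> T) (P : set M -> Prop) :
  injective e -> finitary k P -> finitary k (fun S => P (e @^-1` S)).
Proof.
move=> eI [Q QP].
exists (fun l m s n y => exists s' y', [/\ s = e \o s', y = e \o y' & Q l m s' n y']).
move=> S SQ; apply: QP => l m s Ss [n [y Qy]].
have [|n' [y' [Sy' [s' [z [es ey Qz]]]]]] := SQ l m (e \o s) Ss.
  by exists n, (e \o y), s, y.
have -> : s = s' by apply/funext => i; apply: eI; exact: (congr1 (@^~ i) es).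
by exists n', z; split=> // j; have := Sy' j; rewrite ey.
Qed.

Lemma finitary_op2 L T (f : L -> T -> T -> T) : cle L k ->
  finitary k (fun S => forall l x y, S x -> S y -> S (f l x y)).
Proof.
move=> Lk; have := @finitary_rule L T (fun l m s n y => (0 < n)%N /\
  forall a b, (1 < m)%N -> (forall i, s i = if val i == 0%N then a else b) ->
  forall v, y v = f l a b) Lk.
apply: finitary_sub => S SQ l x y Sx Sy.
pose s (i : 'I_2) := if val i == 0%N then x else y.
have [||n [z [Sz [n0 zE]]]] := SQ l 2%N s.
- by rewrite /s => i; case: ifP.
- exists 1%N, (fun=> f l x y); split=> // a b _ ab _.
  by have := ab ord0; have := ab ord_max; rewrite /s /= => -> ->.
by rewrite -(zE x y _ _ (Ordinal n0)).
Qed.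

Lemma finitary_op1 L T (f : L -> T -> T) : cle L k ->
  finitary k (fun S => forall l x, S x -> S (f l x)).
Proof.
move=> Lk; have := finitary_op2 (fun l x _ => f l x) Lk.
by apply: finitary_sub => S Sf l x Sx; exact: (Sf l x x).
Qed.

Lemma finitary_mem T (t : T) : finitary k (fun S => S t).
Proof.
have : cle unit k by have /cleP[n nI] := kinf; apply: (cle_inj (f := fun=> n 0%N)) => -[] [].
move=> /(@finitary_rule _ _ (fun l m s n y => (0 < n)%N /\ forall j, y j = t)).
apply: finitary_sub => S SQ.
have [[]//||n [y [Sy [n0 yt]]]] := SQ tt 0%N (fun=> t); first by exists 1%N, (fun=> t).
by rewrite -(yt (Ordinal n0)).
Qed.

Lemma finitary_hull T (t0 : T) (P : set T -> Prop) :
  finitary k P -> exists ev : GenTree.tree k -> T, P (range ev).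
Proof. by move=> [Q QP]; have [ev evQ] := skolem_hull t0 Q; exists ev; exact: QP. Qed.

End Finitary.

(** * Submodules as sets *)

Definition subm (R : pzRingType) (M : rmodType R) (S : set M) :=
  S 0 /\ forall a x y, S x -> S y -> S (a *: x + y).

Section Subm.
Context (R : pzRingType) (M : rmodType R) (S : set M) (Sm : subm S).

Lemma subm0 : S 0. Proof. by case: Sm. Qed.

Lemma submZ a x : S x -> S (a *: x).
Proof. by move=> Sx; have := Sm.2 a x 0 Sx subm0; rewrite addr0. Qed.

Lemma submD x y : S x -> S y -> S (x + y).
Proof. by move=> Sx Sy; have := Sm.2 1 x y Sx Sy; rewrite scale1r. Qed.

Lemma submN x : S x -> S (- x).
Proof. by move=> /(submZ (-1)); rewrite scaleN1r. Qed.

Lemma submB x y : S x -> S y -> S (x - y).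
Proof. by move=> Sx Sy; apply: submD => //; exact: submN. Qed.

(** The proof argument lets the closedness instance be inferred. *)
Definition setsub_pred of subm S : {pred M} := fun x => `[< S x >].

Lemma setsub_closed : submod_closed (setsub_pred Sm).
Proof.
split; first exact/asboolP/subm0.
by move=> a x y /asboolP Sx /asboolP Sy; apply/asboolP; exact: Sm.2.
Qed.

HB.instance Definition _ :=
  GRing.isSubmodClosed.Build R^c M (setsub_pred Sm) setsub_closed.

Definition setsub : submodClosed M := setsub_pred Sm.

Lemma mem_setsub x : (x \in setsub) <-> S x.
Proof. by split=> [/asboolP|/asboolP]. Qed.

Lemma setsubE : [set` setsub] = S.
Proof. by apply/seteqP; split=> x /mem_setsub. Qed.

End Subm.

Section SubmLemmas.
Context (R : pzRingType).
Implicit Types M : rmodType R.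

Lemma subm_mem M (S : submodClosed M) : subm [set` S].
Proof. by split=> [|a x y Sx Sy] /=; [exact: rpred0|rewrite rpredD ?rpredZ]. Qed.

Lemma subm_range M M' (f : {linear M -> M'}) : subm (range f).
Proof.
split; first by exists 0; rewrite ?linear0.
by move=> a _ _ [x _ <-] [y _ <-]; exists (a *: x + y); rewrite ?linearP.
Qed.

Lemma subm_image M M' (f : {linear M -> M'}) (S : set M) : subm S -> subm (f @` S).
Proof.
move=> Sm; split; first by exists 0; rewrite ?linear0 //; exact: subm0.
by move=> a _ _ [x Sx <-] [y Sy <-]; exists (a *: x + y); rewrite ?linearP //; exact: Sm.2.
Qed.

Lemma subm_preimage M M' (f : {linear M -> M'}) (S : set M') :
  subm S -> subm (f @^-1` S).
Proof.
move=> Sm; split=> [|a x y Sx Sy] /=; first by rewrite linear0; exact: subm0.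
by rewrite linearP; exact: Sm.2.
Qed.

Lemma subm_add M (S S' : set M) : subm S -> subm S' ->
  subm [set x + y | x in S & y in S'].
Proof.
move=> Sm Sm'; split; first by exists 0; [exact: subm0|exists 0; [exact: subm0|rewrite addr0]].
move=> a _ _ [x Sx [y Sy <-]] [x' Sx' [y' Sy' <-]].
exists (a *: x + x'); first exact: Sm.2.
by exists (a *: y + y'); [exact: Sm'.2|rewrite scalerDr addrACA].
Qed.

Lemma finitary_subm (k : Type) M : cinfinite k -> cle R k ->
  finitary k (@subm R M).
Proof.
move=> kinf Rk; have := finitary_and kinf (finitary_mem kinf (0 : M))
  (finitary_op2 (fun (r : R) (x y : M) => (r : R^c) *: x + y) Rk).
by apply: finitary_sub => S [S0 SP]; split.
Qed.

End SubmLemmas.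

(** * Purity *)

(** The three kinds of embeddings differ only in the shapes of the systems of
equations that have to be reflected: none at all, single equations in one
unknown, and all finite systems. *)
Definition shapes := nat -> nat -> Prop.

Section Purity.
Context (R : pzRingType).
Implicit Types M : rmodType R.

Definition spure (W : shapes) M (S : set M) :=
  forall m n (a : 'I_m -> 'I_n -> R^c) (b : 'I_m -> M), W m n ->
    (forall i, S (b i)) ->
    (exists x : 'I_n -> M, forall i, \sum_(j < n) a i j *: x j = b i) ->
    exists2 x : 'I_n -> M, forall j, S (x j) & forall i, \sum_(j < n) a i j *: x j = b i.

(** For submodules [A] and [S], this says that [(S + A) / A] is pure in [M / A]. *)
Definition pure_mod M (A S : set M) :=
  forall m n (a : 'I_m -> 'I_n -> R^c) (b : 'I_m -> M),
    (forall i, S (b i)) ->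
    (exists x : 'I_n -> M, forall i, A (\sum_(j < n) a i j *: x j - b i)) ->
    exists2 x : 'I_n -> M, forall j, S (x j) & forall i, A (\sum_(j < n) a i j *: x j - b i).

Lemma pure_mod0 W M (S : set M) : pure_mod [set 0] S -> spure W S.
Proof.
move=> Sp m n a b _ Sb [x xb]; have [|y Sy yb] := Sp m n a b Sb.
  by exists x => i; rewrite /= xb subrr.
by exists y => // i; apply/eqP; rewrite -subr_eq0; apply/eqP; exact: yb.
Qed.

(** Purity passes up an extension: first solve modulo [A], then correct the
error inside [A]. *)
Lemma spure_add W M (A S : set M) : subm A -> spure W A -> pure_mod A S ->
  spure W [set x + y | x in S & y in A].
Proof.
move=> Am Ap Sp m n a b Wmn /(_ _)/cid2-/all_sig2[c Sc cb] [x xb].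
have {cb} cb i : exists2 d, A d & c i + d = b i by exact: cb.
move: cb => /(_ _)/cid2-/all_sig2[d Ad cb].
have [|y Sy yc] := Sp m n a c Sc.
  by exists x => i; rewrite xb -cb addrC addKr.
have [||z Az zE] := Ap m n a (fun i => b i - \sum_(j < n) a i j *: y j) Wmn.
- move=> i; rewrite -cb -addrA addrCA; apply: (submD Am) => //.
  by rewrite -opprB; exact: submN.
- exists (fun j => x j - y j) => i; rewrite -xb -sumrB.
  by apply: eq_bigr => j _; rewrite scalerBr.
exists (fun j => y j + z j) => [j|i]; first by exists (y j) => //; exists (z j).
under eq_bigr do rewrite scalerDr.
by rewrite big_split /= zE addrC subrK.
Qed.

Lemma spure_comp W M1 M2 M3 (f : {linear M1 -> M2}) (g : {linear M2 -> M3}) (S : set M1) :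
  injective g -> spure W (f @` S) -> spure W (range g) -> spure W ((g \o f) @` S).
Proof.
move=> gI fp gp m n a b Wmn bE xb.
have {bE} /(_ _)/cid2-/all_sig2[c Sc cb] : forall i, exists2 c, S c & g (f c) = b i by [].
have [|y /(_ _)/cid2-/all_sig2[z _ zy] yb] := gp m n a b Wmn _ xb.
  by move=> i; exists (f (c i)).
have [||w /(_ _)/cid2-/all_sig2[v Sv vw] wb] := fp m n a (fun i => f (c i)) Wmn.
- by move=> i; exists (c i).
- exists z => i; apply: gI; rewrite linear_sum cb -yb.
  by apply: eq_bigr => j _; rewrite linearZ /= zy.
exists (fun j => g (w j)) => [j|i]; first by exists (v j); rewrite //= vw.
by rewrite -cb -wb linear_sum; apply: eq_bigr => j _; rewrite linearZ.
Qed.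

(** The coefficient matrices are coded by lists of lists, so there are at most
[k] of them. *)
Lemma finitary_pure_mod (k : Type) M (A : set M) : cinfinite k -> cle R k ->
  finitary k (@pure_mod M A).
Proof.
move=> kinf Rk.
have Lk : cle (nat * seq (seq R))%type k.
  apply: cle_trans (cle_square kinf); apply: (cle_prod kinf).
  have sk (L : Type) : cle L k -> cle (seq L) k.
    move=> /cleP[f fI]; apply: cle_trans (cle_seq kinf).
    exact: cle_inj (inj_map fI).
  exact/sk/sk.
have := @finitary_rule k (nat * seq (seq R))%type M (fun l m b n x => n = l.1 /\ forall i : 'I_m,
  A (\sum_(j < n) (nth 0 (nth [::] l.2 i) j : R^c) *: x j - b i)) Lk.
apply: finitary_sub => S SQ m n a b Sb [x xb].
pose l := [seq [seq a i j : R | j <- enum 'I_n] | i <- enum 'I_m].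
have lE (i : 'I_m) (j : 'I_n) : nth 0 (nth [::] l i) j = a i j.
  rewrite (nth_map i) ?size_enum_ord // nth_ord_enum.
  by rewrite (nth_map j) ?size_enum_ord // nth_ord_enum.
have lS y (i : 'I_m) : \sum_(j < n) (nth 0 (nth [::] l i) j : R^c) *: y j =
    \sum_(j < n) a i j *: y j :> M.
  by apply: eq_bigr => j _; rewrite lE.
have [|n' [y [Sy [/= nn yb]]]] := SQ (n, l) m b Sb.
  by exists n, x; split=> // i; rewrite lS.
by subst n'; exists y => // i; rewrite -lS.
Qed.

End Purity.

(** * Filtrations *)

Section WellOrdered.
Context (J : Type).
Implicit Type lt : J -> J -> Prop.

Definition well_ordered lt :=
  well_founded lt /\ forall i j, [\/ lt i j, i = j | lt j i].

Lemma wf_asym lt i j : well_founded lt -> lt i j -> lt j i -> False.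
Proof.
move=> ltwf; elim: (ltwf i) j => {}i _ IH j ij ji; exact: (IH j ji i ji ij).
Qed.

Lemma wf_irr lt i : well_founded lt -> ~ lt i i.
Proof. by move=> ltwf ii; exact: (wf_asym ltwf ii ii). Qed.

Lemma wo_trans lt i j k : well_ordered lt -> lt i j -> lt j k -> lt i k.
Proof.
move=> [ltwf lttot] ij jk; case: (lttot i k) => // [ik|ki].
  by case: (wf_asym ltwf ij); rewrite ik.
exfalso; elim: (ltwf i) j k ij jk ki => {}i _ IH j k ij jk ki; exact: (IH k ki i j ki ij jk).
Qed.

Lemma wo_min lt (P : J -> Prop) : well_founded lt -> (exists j, P j) ->
  exists2 j, P j & forall i, lt i j -> ~ P i.
Proof.
move=> ltwf [j]; elim: (ltwf j) => {}j _ IH Pj.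
have [[i [ij Pi]]|nP] := pselect (exists i, lt i j /\ P i); first exact: (IH i).
by exists j => // i ij Pi; apply: nP; exists i.
Qed.

End WellOrdered.

Lemma well_order_lt (I : eqType) (le : rel I) : well_order le ->
  well_ordered (fun i j => le i j && (i != j)) /\ antisymmetric le.
Proof.
move=> wo; have woT : wo_chain le (predT : {pred I}) by move=> A _; exact: wo.
have anti : antisymmetric le by move=> x y; exact: (wo_chain_antisymmetric woT).
split; last exact: anti.
split; last first.
  move=> i j; case: (eqVneq i j) => [|ij]; first by constructor 2.
  case/orP: (wo_chainW woT (erefl : i \in predT) (erefl : j \in predT)) => h.
    by constructor 1; rewrite h.
  by constructor 3; rewrite h.
set lt := fun i j => _; move=> i; apply: contrapT => ni.
have [|z [[/asboolP nz zmin] _]] := wo (fun i => `[< ~ Acc lt i >]).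
  by exists i; exact/asboolP.
apply: nz; constructor => y /andP[yz yNz]; apply: contrapT => ny.
have zy : le z y by apply: zmin; exact/asboolP.
by move: yNz; rewrite (anti y z) ?yz ?zy ?eqxx.
Qed.

Section LinearMaps.
Context (R : pzRingType) (A B : rmodType R) (f : A -> B) (fl : linear f).

Definition lin_fun of linear f := f.
HB.instance Definition _ := GRing.isLinear.Build R^c A B *:%R (lin_fun fl) fl.
Definition mklin : {linear A -> B} := lin_fun fl.

End LinearMaps.

Lemma qpi_linear (R : pzRingType) (M : rmodType R) (S : submodClosed M) : linear (qpi S).
Proof. by move=> a x y; rewrite qmodD -qscaleE. Qed.

Definition qproj (R : pzRingType) (M : rmodType R) (S : submodClosed M) :
  {linear M -> qmod S} := mklin (@qpi_linear R M S).

Lemma qproj_eq0 (R : pzRingType) (M : rmodType R) (S : submodClosed M) x :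
  qproj S x = 0 <-> x \in S.
Proof.
have := qmodE S x 0; rewrite subr0 => ->.
have -> : qpi S 0 = 0 := linear0 (qproj S).
by split=> [h|/eqP h]; [apply/eqP|].
Qed.

Section Filtrations.
Context (R : pzRingType).
Implicit Types M N : rmodType R.

(** [f] induces an isomorphism from [Y / X] onto [N].  A total function with
conditions on [Y] avoids moving between submodules of submodules. *)
Definition subquotient M N (X Y : set M) (f : M -> N) :=
  [/\ forall a x y, Y x -> Y y -> f (a *: x + y) = a *: f x + f y,
      forall n, exists2 y, Y y & f y = n
    & forall y, Y y -> f y = 0 <-> X y].

Lemma subquotient_zero M N (X Y : set M) : (forall n : N, n = 0) -> subm Y ->
  Y `<=` X -> subquotient X Y (fun=> 0 : N).
Proof.
move=> N0 Ym YX; split=> [a x y _ _|n|y Yy]; first by rewrite scaler0 addr0.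
  by exists 0; [exact: subm0|rewrite [n]N0].
by split=> // _; exact: YX.
Qed.

Lemma subquotientB M N (X Y : set M) (f : M -> N) x y :
  subquotient X Y f -> Y x -> Y y -> f (x - y) = f x - f y.
Proof.
by move=> [fl _ _] Yx Yy; rewrite addrC -scaleN1r fl // scaleN1r addrC.
Qed.

Lemma subquotient_miso M N (S T : submodClosed M) : [set` S] `<=` [set` T] ->
  miso (qmod (relsub S T)) N <-> exists f : M -> N, subquotient [set` S] [set` T] f.
Proof.
move=> ST; split=> [[g gbij]|[f fST]].
  have gI := bij_inj gbij; have [g' g'K gK'] := gbij.
  have /choice[f fE] : forall x, exists y : N,
      forall h : x \in T, y = g (qpi (relsub S T) (exist _ x h)).
    move=> x; have [h|nh] := pselect (is_true (x \in T)); last by exists 0.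
    exists (g (qpi (relsub S T) (exist _ x h))) => h'; congr (g (qpi _ _)).
    exact: val_inj.
  exists f; split=> [a x y Tx Ty|n|y Ty].
  - have Txy : a *: x + y \in T by rewrite rpredD ?rpredZ.
    rewrite !fE -linearP -[_ *: qpi _ _ + _]qpi_linear; congr (g (qpi _ _)).
    exact: val_inj.
  - have : exists u, g' n = qpi (relsub S T) u.
      by move: (g' n); apply: qpiP => u; exists u.
    case=> -[u Tu] uE; exists u; first exact: Tu.
    by rewrite (fE u Tu) -uE gK'.
  - rewrite fE; have := qproj_eq0 (relsub S T) (exist _ y Ty).
    rewrite unfold_in /= => <-; split=> [h|h0]; last by rewrite (h0 : qpi _ _ = 0); exact: linear0.
    by apply: gI; rewrite linear0.
have [fl fs fk] := fST.
pose h (q : qmod (relsub S T)) := f (val (repr q)).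
have hE u : h (qpi (relsub S T) u) = f (val u).
  have : u - repr (qpi (relsub S T) u) \in relsub S T.
    by rewrite qmodE /qpi reprK.
  rewrite unfold_in /= => Su; apply/esym/eqP; rewrite -subr_eq0 -(subquotientB fST); last 2 first.
    exact: valP.
    exact: valP.
  by apply/eqP/fk; [exact: ST|].
have hl : linear h.
  move=> a; elim/qpiP=> u; elim/qpiP=> v.
  have -> : a *: qpi (relsub S T) u + qpi (relsub S T) v = qpi (relsub S T) (a *: u + v).
    by rewrite qpi_linear.
  by rewrite !hE /= fl //; exact: valP.
exists (mklin hl).
have : injective (mklin hl).
  move=> q q'; elim/qpiP: q => u; elim/qpiP: q' => v; rewrite /= /lin_fun !hE => e.
  apply/eqP; rewrite -qmodE unfold_in /=; apply/fk.
    by apply: (submB (subm_mem T)); exact: valP.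
  by rewrite (subquotientB fST) ?e ?subrr //; exact: valP.
move=> hI; have /choice[g gK] : forall n, exists q, mklin hl q = n.
  move=> n; have [y Ty <-] := fs n; exists (qpi (relsub S T) (exist _ y Ty)).
  by rewrite /= /lin_fun hE.
by exists g => // q; apply: hI; rewrite gK.
Qed.

(** A chain of submodules indexed by a well-ordered set without distinguishing
successor and limit indices: the factor at [j] is that of [G j] by the union of
the earlier members. *)
Definition below (J : Type) (lt : J -> J -> Prop) M (G : J -> set M) j : set M :=
  [set x | x = 0 \/ exists2 i, lt i j & G i x].

Definition filtration (C : mod_class R) M (J : Type) lt (G : J -> set M) :=
  [/\ well_ordered lt,
      forall j, subm (G j),
      forall i j, lt i j -> G i `<=` G j,
      forall x, x = 0 \/ exists j, G j x
    & forall j, exists2 N, C N & exists f : M -> N, subquotient (below lt G j) (G j) f].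

Definition chain_filtered (C : mod_class R) M :=
  exists (J : Type) (lt : J -> J -> Prop) (G : J -> set M), filtration C lt G.

Definition trivial_mod M := forall x : M, x = 0.

Section Basic.
Context (C : mod_class R) (M : rmodType R) (J : Type).
Context (lt : J -> J -> Prop) (G : J -> set M) (GF : filtration C lt G).

Lemma below_sub j : below lt G j `<=` G j.
Proof.
case: GF => _ Gm Ginc _ _ x [->|[i ij Gx]]; [exact: subm0|exact: Ginc ij _ Gx].
Qed.

Lemma below_subm j : subm (below lt G j).
Proof.
case: GF => wo Gm Ginc _ _; split=> [|a x y]; first by left.
have H i z : lt i j -> G i z -> below lt G j z by move=> ij Gz; right; exists i.
have Z i z : lt i j -> G i z -> below lt G j (a *: z) by move=> ij /(submZ (Gm i) a); exact: H.
move=> [->|[i ij Gx]] [->|[i' ij' Gy]].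
- by left; rewrite scaler0 addr0.
- by rewrite scaler0 add0r; exact: H Gy.
- by rewrite addr0; exact: Z Gx.
case: wo => _ /(_ i i')[ii'|ii'|ii'].
- by apply: (H i') => //; apply: (Gm i').2 => //; exact: Ginc ii' _ Gx.
- by subst i'; apply: (H i) => //; exact: (Gm i).2.
- by apply: (H i) => //; apply: (Gm i).2 => //; exact: Ginc ii' _ Gy.
Qed.

Lemma first_index x : x <> 0 -> exists2 j, G j x & ~ below lt G j x.
Proof.
case: GF => -[ltwf _] _ _ cov _ x0; case: (cov x) => [//|/(wo_min ltwf)[j Gj jmin]].
by exists j => // -[//|[i /jmin]].
Qed.

Lemma first_index_uniq x i j :
  G i x -> ~ below lt G i x -> G j x -> ~ below lt G j x -> i = j.
Proof.
case: GF => -[_ tot] _ _ _ _ Gi ni Gj nj; case: (tot i j) => // ij.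
  by case: nj; right; exists i.
by case: ni; right; exists j.
Qed.

End Basic.

(** A submodule [H] is adapted to a filtration when it meets each factor either
trivially or entirely.  Then the factors of [H] and of [M / H] are again factors of
the filtration, or zero. *)
Definition adapted (J : Type) (lt : J -> J -> Prop) M (G : J -> set M) (H : set M) :=
  forall j, H `&` G j `<=` below lt G j \/
    G j `<=` [set x + y | x in below lt G j & y in H].

(** It is enough that whenever [H] contains an element that first appears in
[G j], it contains representatives of the whole factor at [j]. *)
Lemma finitary_adapted (k : Type) (C : mod_class R) M (J : Type)
    (lt : J -> J -> Prop) (G : J -> set M) :
  cinfinite k -> (forall N, C N -> cle N k) -> filtration C lt G ->
  finitary k (adapted lt G).
Proof.
move=> kinf Ck GF; have [wo Gm Ginc cov fac] := GF.
have /choice[t tE] : forall j, exists t : k -> M, (forall l, G j (t l)) /\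
    forall x, G j x -> exists l, below lt G j (x - t l).
  move=> j; have [N CN [f fj]] := fac j; have [fl fs fk] := fj.
  have /choice[s sP] : forall n, exists y, G j y /\ f y = n.
    by move=> n; have [y Gy fy] := fs n; exists y.
  have /cleP[g gI] := Ck N CN.
  have /choice[g' g'K] : forall l, exists n, forall n', g n' = l -> n = n'.
    move=> l; have [[n nl]|nn] := pselect (exists n, g n = l).
      by exists n => n' n'l; apply: gI; rewrite n'l.
    by exists 0 => n' n'l; case: nn; exists n'.
  exists (fun l => s (g' l)); split=> [l|x Gx]; first by have [] := sP (g' l).
  exists (g (f x)); rewrite (g'K _ (f x)) //; have [Gs fsx] := sP (f x).
  by apply/fk; [exact: submB|rewrite (subquotientB fj) ?fsx ?subrr].
have /choice[u uE] : forall x, exists u : k -> M,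
    forall j, G j x -> ~ below lt G j x -> u = t j.
  move=> x; have [[j Gj nj]|nj] := pselect (exists2 j, G j x & ~ below lt G j x).
    by exists (t j) => i Gi ni; rewrite (first_index_uniq GF Gi ni Gj nj).
  by exists (fun=> 0) => j Gj bj; case: nj; exists j.
have := finitary_op1 (fun l x => u x l) (cle_refl k).
apply: finitary_sub => H Hu j.
have [[x [[Hx Gx] nx]]|nx] := pselect (exists x, (H `&` G j) x /\ ~ below lt G j x); last first.
  by left=> x HGx; apply: contrapT => bx; apply: nx; exists x.
right=> y Gy; have [_ /(_ y Gy)[l bl]] := tE j.
exists (y - t j l) => //; exists (t j l); last exact: subrK.
by rewrite -(uE x j Gx nx); exact: Hu.
Qed.

Lemma adapted_filtered (C : mod_class R) M (J : Type) (lt : J -> J -> Prop)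
    (G : J -> set M) (H : submodClosed M) (Z : rmodType R) :
  trivial_mod Z -> C Z -> filtration C lt G -> adapted lt G [set` H] ->
  chain_filtered C (submod H).
Proof.
move=> Z0 CZ GF HG; have [wo Gm Ginc cov fac] := GF.
exists J, lt, (fun j => submod_incl H @^-1` G j).
have bE j : below lt (fun j => submod_incl H @^-1` G j) j = submod_incl H @^-1` below lt G j.
  apply/seteqP; split=> x [x0|[i ij Gx]]; try by right; exists i.
    by left; rewrite x0 linear0.
  by left; exact: val_inj.
split=> // [j|i j ij x|x|j].
- exact: subm_preimage.
- exact: Ginc.
- case: (cov (submod_incl H x)) => [x0|[j Gj]]; [left; exact: val_inj|by right; exists j].
rewrite bE; case: (HG j) => [triv|full].
  exists Z => //; exists (fun=> 0); apply: subquotient_zero => //.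
    exact: subm_preimage.
  by move=> x Gx; apply: triv; split=> //; exact: valP.
have [N CN [f fj]] := fac j; have [fl fs fk] := fj.
exists N => //; exists (f \o submod_incl H); split=> [a x y Gx Gy|n|y Gy] /=.
- by rewrite -fl //; congr f; exact: (linearP (submod_incl H)).
- have [y Gy <-] := fs n; have [v bv [w Hw vw]] := full y Gy.
  have Gv := below_sub GF bv.
  have wE : w = y - v by rewrite -vw addrAC subrr add0r.
  have Gw : G j w by rewrite wE; exact: submB.
  exists (exist _ w Hw : submod H); first exact: Gw.
  by rewrite /= wE (subquotientB fj) // (iffRL (fk v Gv)) // subr0.
- exact: fk.
Qed.

End Filtrations.

Section Glue.
Context (R : pzRingType) (C : mod_class R) (Z : rmodType R).
Context (Z0 : trivial_mod Z) (CZ : C Z).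

Definition lt_sum J1 J2 (lt1 : J1 -> J1 -> Prop) (lt2 : J2 -> J2 -> Prop)
    (u v : J1 + J2) :=
  match u, v with
  | inl i, inl j => lt1 i j
  | inl _, inr _ => True
  | inr _, inl _ => False
  | inr i, inr j => lt2 i j
  end.

Lemma wo_sum J1 J2 (lt1 : J1 -> J1 -> Prop) (lt2 : J2 -> J2 -> Prop) :
  well_ordered lt1 -> well_ordered lt2 -> well_ordered (lt_sum lt1 lt2).
Proof.
move=> [wf1 tot1] [wf2 tot2].
have acc1 i : Acc (lt_sum lt1 lt2) (inl i).
  by elim: (wf1 i) => {}i _ IH; constructor; case=> [j ji|j []]; exact: IH.
split=> [[i|i]|[i|i] [j|j]] /=.
- exact: acc1.
- elim: (wf2 i) => {}i _ IH; constructor; case=> [j _|j ji]; [exact: acc1|exact: IH].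
- by case: (tot1 i j) => [?|->|?]; [constructor 1|constructor 2|constructor 3].
- by constructor 1.
- by constructor 3.
- by case: (tot2 i j) => [?|->|?]; [constructor 1|constructor 2|constructor 3].
Qed.

(** If [P = i X + j Y] and the preimage [B] of [i X] under [j] is adapted to a
filtration of [Y], then [P / i X], being [Y / B], is filtered, and a filtration of
[X] can be prolonged to [P].  This covers extensions, pushouts and direct sums. *)
Lemma glue_filtered (X Y P : rmodType R) (J : Type) (lt : J -> J -> Prop)
    (G : J -> set Y) (i : {linear X -> P}) (j : {linear Y -> P}) (B : set Y) :
  injective i -> (forall p, exists x y, p = i x + j y) ->
  (forall y, B y <-> exists x, j y = i x) ->
  chain_filtered C X -> filtration C lt G -> adapted lt G B -> chain_filtered C P.
Proof.
move=> iI ijP Bij [J1 [lt1 [G1 GF1]]] GF BG.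
have [wo1 Gm1 Ginc1 cov1 fac1] := GF1; have [wo Gm Ginc cov fac] := GF.
pose up (S : set Y) := [set x + y | x in range i & y in j @` S].
pose H (u : J1 + J) := match u with inl a => i @` G1 a | inr b => up (G b) end.
have upP S p : up S p <-> exists x y, S y /\ p = i x + j y.
  split=> [[_ [x _ <-] [_ [y Sy <-] <-]]|[x [y [Sy ->]]]]; first by exists x, y.
  by exists (i x); [exists x|exists (j y); [exists y|]].
have bl a : below (lt_sum lt1 lt) H (inl a) = i @` below lt1 G1 a.
  apply/seteqP; split=> [p [->|[[b|b] // ba [x Gx <-]]]|_ [x [->|[b ba Gx]] <-]].
  - by exists 0; [left|exact: linear0].
  - by exists x => //; right; exists b.
  - by left; rewrite linear0.
  - by right; exists (inl b) => //; exists x.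
have br b : below (lt_sum lt1 lt) H (inr b) = up (below lt G b).
  apply/seteqP; split=> [p|p /upP[x [y [[->|[c cb Gy]] ->]]]].
  - move=> [->|[[a|c] ab Hp]]; apply/upP.
    + by exists 0, 0; rewrite !linear0 addr0; split=> //; left.
    + by move: Hp => [x Gx <-]; exists x, 0; rewrite linear0 addr0; split=> //; left.
    + by move: Hp => /upP[x [y [Gy ->]]]; exists x, y; split=> //; right; exists c.
  - case: (cov1 x) => [->|[a Ga]]; first by left; rewrite !linear0 addr0.
    by right; exists (inl a) => //; exists x => //; rewrite linear0 addr0.
  - by right; exists (inr c) => //; apply/upP; exists x, y.
have Hm u : subm (H u).
  case: u => [a|b]; first exact: subm_image.
  by apply: subm_add; [exact: subm_range|exact: subm_image].
exists _, (lt_sum lt1 lt), H; split; [exact: wo_sum|exact: Hm| | |].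
- move=> [a|a] [b|b] //= ab.
  + by move=> _ [x Gx <-]; exists x => //; exact: Ginc1 ab _ Gx.
  + by move=> _ [x Gx <-]; apply/upP; exists x, 0; rewrite linear0 addr0; split=> //; exact: subm0.
  + by move=> p /upP[x [y [Gy ->]]]; apply/upP; exists x, y; split=> //; exact: Ginc ab _ Gy.
- move=> p; have [x [y ->]] := ijP p; case: (cov y) => [->|[b Gb]]; last first.
    by right; exists (inr b); apply/upP; exists x, y.
  rewrite linear0 addr0; case: (cov1 x) => [->|[a Ga]]; first by left; exact: linear0.
  by right; exists (inl a); exists x.
case=> [a|b].
- rewrite bl; have [N CN [f [fl fs fk]]] := fac1 a; exists N => //.
  have /choice[i' i'P] : forall p, exists x, forall x', i x' = p -> x = x'.
    move=> p; have [[x xp]|np] := pselect (exists x, i x = p).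
      by exists x => x' x'p; apply: iI; rewrite xp.
    by exists 0 => x' x'p; case: np; exists x'.
  have i'K x : i' (i x) = x by exact: i'P.
  exists (f \o i'); split=> [r _ _ [x Gx <-] [y Gy <-]|n|_ [x Gx <-]] /=.
  + by rewrite -linearP !i'K fl.
  + by have [x Gx <-] := fs n; exists (i x); [exists x|rewrite i'K].
  + rewrite i'K fk //; split=> [bx|[y by_ /iI <-] //].
    by exists x.
rewrite br; case: (BG b) => [triv|full]; last first.
  exists Z => //; exists (fun=> 0); apply: (subquotient_zero Z0 (Hm (inr b))).
  move=> p /upP[x [y [/full[v bv [w Bw <-]] ->]]]; have [x' jw] := (Bij w).1 Bw.
  by apply/upP; exists (x + x'), v; split=> //; rewrite !linearD jw addrA addrAC.
have [N CN [f fb]] := fac b; have [fl fs fk] := fb.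
(* two decompositions of an element differ by an element of B *)
have uniq x y x' y' : G b y -> G b y' -> i x + j y = i x' + j y' -> f y = f y'.
  move=> Gy Gy' e; apply/eqP; rewrite -subr_eq0 -(subquotientB fb) //; apply/eqP.
  have Gyy := submB (Gm b) Gy Gy'; apply/fk => //; apply: triv; split=> //.
  apply/Bij; exists (x' - x); rewrite !linearB; apply/eqP.
  by rewrite subr_eq addrAC eq_sym subr_eq -e addrC.
have /choice[g gE] : forall p, exists n, forall x y, G b y -> p = i x + j y -> n = f y.
  move=> p; have [[x [y [Gy pE]]]|np] := pselect (exists x y, G b y /\ p = i x + j y).
    by exists (f y) => x' y' Gy' pE'; apply: (uniq x y x' y') => //; rewrite -pE.
  by exists 0 => x y Gy pE; case: np; exists x, y.
have gij x y : G b y -> g (i x + j y) = f y by move=> Gy; exact: (gE _ x y).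
exists N => //; exists g; split=> [r p q|n|p].
- move=> /upP[x [y [Gy ->]]] /upP[x' [y' [Gy' ->]]].
  have -> : r *: (i x + j y) + (i x' + j y') = i (r *: x + x') + j (r *: y + y').
    by rewrite !linearP scalerDr addrACA.
  by rewrite !gij ?fl //; exact: (Gm b).2.
- have [y Gy <-] := fs n; exists (j y); last by rewrite -[j y]add0r -(linear0 i) gij.
  by apply/upP; exists 0, y; rewrite linear0 add0r.
- move=> /upP[x [y [Gy ->]]]; rewrite gij // fk //; split=> [by_|].
    by apply/upP; exists x, y.
  move=> /upP[x' [y' [by' e]]]; apply/fk => //.
  by rewrite (uniq _ _ _ _ Gy (below_sub GF by') e); apply/fk; [exact: (below_sub GF)|].
Qed.

End Glue.

(** Limit steps count as zero factors. *)
Lemma filtered_chain (R : pzRingType) (C : mod_class R) (Z M : rmodType R) :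
  trivial_mod Z -> C Z -> filtered C M -> chain_filtered C M.
Proof.
move=> Z0 CZ [I [le [top [F]]]] /=.
move=> [[wo letop] Finc [F0 Ftop] Flim Fsucc].
have [lewo anti] := well_order_lt wo; pose lt i j := le i j && (i != j).
exists I, lt, (fun i => [set` F i]).
have Fm i : subm [set` F i] by exact: subm_mem.
have ltF i j : lt i j -> [set` F i] `<=` [set` F j] by move=> /andP[/Finc].
have bF i : below lt (fun i => [set` F i]) i `<=` [set` F i].
  by move=> x [->|[j ji]]; [exact: subm0|exact: ltF].
have zero i : [set` F i] `<=` below lt (fun i => [set` F i]) i ->
    exists2 N, C N & exists f : M -> N,
      subquotient (below lt (fun i => [set` F i]) i) [set` F i] f.
  by move=> Fb; exists Z => //; exists (fun=> 0); exact: subquotient_zero.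
split=> // [x|j]; first by right; exists top; rewrite Ftop.
have [/F0 e|nbot] := pselect (forall k, le j k).
  by apply: zero => x; rewrite e => ->; left.
have [[i [ij imax]]|nsucc] := pselect (exists i, lt i j /\ forall k, lt i k -> le j k); last first.
  apply: zero => x; rewrite Flim; last by split.
  by move=> [k kj Fx]; right; exists k.
have e : below lt (fun i => [set` F i]) j = [set` F i].
  apply/seteqP; split=> [x [->|[k kj Fx]]|x Fx]; [exact: subm0| |by right; exists i].
  case: (lewo.2 k i) => [ki|<- //|/imax jk]; first exact: ltF ki _ Fx.
  by case/andP: kj => kj; rewrite (anti k j) ?kj ?jk ?eqxx.
have [N CN iso] := Fsucc i j (conj ij imax); exists N => //.
by rewrite e; apply/subquotient_miso => //; exact: ltF.
Qed.

(** The submodules [below], with the whole module on top, form a continuous chain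
whose successor steps are the given factors. *)
Lemma chain_filtered_filtered (R : pzRingType) (C : mod_class R) (M : rmodType R) :
  chain_filtered C M -> filtered C M.
Proof.
move=> [J [lt [G GF]]].
have [wo Gm Ginc cov fac] := GF.
pose ltO (i j : option J) := match i, j with
  | Some i, Some j => lt i j | Some _, None => True | None, _ => False end.
have woO : well_ordered ltO.
  case: wo => wf tot; have acc i : Acc ltO (Some i).
    by elim: (wf i) => {}i _ IH; constructor; case=> [j ji|[]]; exact: IH.
  split=> [[i|]|[i|] [j|]] /=.
  - exact: acc.
  - by constructor; case=> [j _|[]]; exact: acc.
  - by case: (tot i j) => [?|->|?]; [constructor 1|constructor 2|constructor 3].
  - by constructor 1.
  - by constructor 3.
  - by constructor 2.
pose I : eqType := {classic option J}; pose le : rel I := fun i j => `[< ltO i j \/ i = j >].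
pose Fs (i : I) : set M := [set x | x = 0 \/ exists2 k, ltO (Some k) i & G k x].
have FsE j : Fs (Some j) = below lt G j by [].
have Ftop : Fs None = setT.
  by apply/seteqP; split=> // x _; case: (cov x) => [->|[j Gj]]; [left|right; exists j].
have Fm i : subm (Fs i).
  case: i => [j|]; first exact: below_subm GF j.
  by rewrite Ftop.
have ltE (i j : I) : le i j && (i != j) <-> ltO i j.
  split=> [/andP[/asboolP[//|->]]|ij]; first by rewrite eqxx.
  apply/andP; split; first by apply/asboolP; left.
  by apply/eqP => e; apply: (wf_irr (i := j) woO.1); rewrite -{1}e.
have leNgt (i j : I) : ~ le i j -> ltO j i.
  by case: (woO.2 i j) => // [ij|ij] []; apply/asboolP; [left|right].
have ltNge (i j : I) : ltO j i -> ~ le i j.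
  move=> ji /asboolP[ij|ij]; first exact: wf_asym woO.1 ij ji.
  by apply: (wf_irr (i := i) woO.1); rewrite {1}ij.
have anti : antisymmetric le.
  move=> i j /andP[ij ji]; case: (woO.2 i j) => // /ltNge; contradiction.
exists I, le, None, (fun i => setsub (Fm i)); split.
- split; last by case=> [j|]; apply/asboolP; [left|right].
  apply: antisymmetric_well_order => // A /(wo_min woO.1)[z Az zmin].
  exists z; split=> // x Ax; apply: contrapT => /leNgt xz; exact: zmin xz Ax.
- move=> i j /asboolP[ij|-> //]; rewrite !setsubE => x [->|[k ki Gx]]; first exact: subm0.
  by right; exists k => //; exact: wo_trans ki ij.
- split; rewrite ?setsubE // => i ibot; rewrite setsubE.
  apply/seteqP; split=> [x [//|[k ki]]|x ->]; last exact: subm0.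
  by case: (ltNge _ _ ki).
- move=> i [nbot nsucc]; rewrite setsubE.
  apply/seteqP; split=> [x [->|[k ki Gx]]|x [k /ltE ki]]; last first.
  + rewrite /= mem_setsub => -[->|[l lk Gx]]; first exact: subm0.
    by right; exists l => //; exact: wo_trans lk ki.
  + apply: contrapT => nx; apply: nsucc; exists (Some k : I); split; first exact/ltE.
    move=> l /ltE kl; apply: contrapT => /leNgt li; apply: nx; exists l; first exact/ltE.
    by apply/mem_setsub; right; exists k.
  + move: nbot => /existsNP[k /leNgt ki]; exists k; first exact/ltE.
    by apply/mem_setsub; exact: subm0.
- move=> [k|] j [/ltE kj kmax]; last by case: j kj {kmax}.
  have [N CN fk] := fac k; exists N => //; apply/subquotient_miso.
    rewrite !setsubE => x [->|[l lk Gx]]; first exact: subm0.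
    by right; exists l => //; exact: wo_trans lk kj.
  rewrite !setsubE (_ : Fs j = G k) //.
  apply/seteqP; split=> [x [->|[l lj Gx]]|x Gx]; [exact: subm0| |by right; exists k].
  case: (wo.2 l k) => [lk|<- //|kl]; first exact: Ginc lk _ Gx.
  have := kmax (Some l); rewrite ltE => /(_ kl)/asboolP[/(wf_asym woO.1)/(_ lj)|e] //.
  by case: (wf_irr woO.1 (i := j)); rewrite {1}e.
Qed.

(** * Cardinality and presentations *)

Section Small.
Context (R : pzRingType) (k : Type) (kinf : cinfinite k) (Rk : cle R k).

(** An element of a free module is coded by the list of its nonzero
coordinates. *)
Lemma cle_free (X : Type) : cle X k -> cle (free_mod R X) k.
Proof.
move=> Xk; apply: (@cle_trans (seq (X * R))); last first.
  have /cleP[f fI] := cle_trans (cle_prod Xk Rk) (cle_square kinf).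
  exact: cle_trans (cle_inj (inj_map fI)) (cle_seq kinf).
move: X {Xk}; elim/Peq => X.
have /choice[l lP] : forall c : free_mod R X, exists l : seq (X * R),
    forall x r, (x, r) \in l <-> val c x = r /\ val c x != 0.
  move=> c; have /asboolP/finite_seqP[s sE] := valP c.
  have sP x : x \in s <-> val c x != 0.
    by have /(congr1 (@^~ x)) := sE; rewrite /= => ->.
  exists [seq (x, val c x : R) | x <- s] => x r.
  by split=> [/mapP[y /sP cy [-> ->]]|[<- /sP xs]] //; exact: map_f.
have eq_at c d x : l c = l d -> val c x != 0 -> val d x = val c x.
  move=> cd cx; have : (x, val c x : R) \in l c by apply/lP.
  by rewrite cd => /lP[].
apply: (cle_inj (f := l)) => c d cd; apply: val_inj; apply/funext => x.
have [c0|cx] := eqVneq (val c x) 0; last by rewrite (eq_at c d).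
have [d0|dx] := eqVneq (val d x) 0; first by rewrite c0 d0.
by rewrite (eq_at d c).
Qed.

Lemma cle_qmod (M : rmodType R) (S : submodClosed M) : cle M k -> cle (qmod S) k.
Proof.
apply: cle_trans; apply: (cle_surj (f := qpi S)).
by apply: qpiP => x; exists x.
Qed.

Lemma cle_presented (ks : cardinal) (M : rmodType R) :
  succ_cardinal k ks -> lt_presented ks M -> cle M k.
Proof.
move=> ksP [X [Y [/(clt_succ _ ksP) Xk _ [f fbij]]]].
apply: cle_trans (cle_qmod (span Y) (cle_free Xk)).
by have [g _ gK] := fbij; exact: (cle_inj (can_inj gK)).
Qed.

End Small.

Section TrivialModule.
Context (R : pzRingType).

Definition zero_mod : rmodType R := qmod (span (set0 : set (free_mod R False))).

Lemma zero_mod_trivial : trivial_mod zero_mod.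
Proof.
apply: qpiP => x; have -> : x = 0 by apply: val_inj; apply/funext => -[].
exact: (linear0 (qproj _)).
Qed.

Lemma zero_mod_presented (k ks : cardinal) :
  succ_cardinal k ks -> lt_presented ks zero_mod.
Proof.
move=> ksP; exists False, set0; split.
- by apply/(clt_succ _ ksP); apply: (cle_inj (f := fun x : False => match x with end)) => -[].
- apply/(clt_succ _ ksP).
  have f0 (x : set_type (set0 : set (free_mod R False))) : False by have := set_valP x.
  by apply: (cle_inj (f := fun x => match f0 x with end)) => x; case: (f0 x).
- by exists idfun; exists idfun.
Qed.

End TrivialModule.

(** * Embeddings *)

Section Shapes.
Context (R : pzRingType).
Implicit Types A B M : rmodType R.

Lemma img_range A B (f : {linear A -> B}) : [set` img f] = range f.
Proof.
by apply/seteqP; split=> [y /asboolP[x <-]|_ [x _ <-]] /=; [exists x|apply/asboolP; exists x].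
Qed.

Lemma range_incl M (S : submodClosed M) : range (submod_incl S) = [set` S].
Proof.
apply/seteqP; split=> [_ [x _ <-]|x Sx]; first exact: valP.
by exists (exist _ x Sx : submod S).
Qed.

Lemma RD_spure M (S : submodClosed M) :
  RD_submod S <-> spure (fun m n => m = 1%N /\ n = 1%N) [set` S].
Proof.
split=> [RD m n a b [m1 n1]|SP r].
  subst m n => Sb [x xb].
  have sum1 (y : 'I_1 -> M) i : \sum_(j < 1) a i j *: y j = a ord0 ord0 *: y ord0.
    by rewrite big_ord1 (ord1 i).
  have [y Sy yb] : ((fun x : M => a ord0 ord0 *: x) @` [set` S]) (b ord0).
    rewrite -RD; split; first exact: Sb.
    by exists (x ord0) => //; rewrite -(sum1 x ord0) xb.
  by exists (fun=> y) => // i; rewrite sum1 yb (ord1 i).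
apply/seteqP; split=> [z [Sz [x _ xz]]|_ [x Sx <-]]; last first.
  by split; [exact: rpredZ|exists x].
have [//||y Sy /(_ ord0)] := SP 1%N 1%N (fun _ _ => r) (fun=> z) (conj erefl erefl).
  by exists (fun=> x) => i; rewrite big_ord1.
by rewrite big_ord1 => yz; exists (y ord0) => //; exact: Sy.
Qed.

Lemma embedding_shape (E : mor_class R) :
  E = @embedding R \/ E = @RD_embedding R \/ E = @pure_embedding R ->
  exists W, forall A B (f : {linear A -> B}), E A B f <-> injective f /\ spure W (range f).
Proof.
case=> [->|[->|->]].
- by exists (fun _ _ => False) => A B f; split=> [fI|[]//]; split=> // m n a b [].
- by exists (fun m n => m = 1%N /\ n = 1%N) => A B f; rewrite /RD_embedding -img_range RD_spure.
- exists (fun _ _ => True) => A B f; rewrite /pure_embedding -img_range.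
  split=> -[fI fp]; split=> // m n a b; first exact: (fun _ => fp m n a b).
  exact: (fp m n a b Logic.I).
Qed.

End Shapes.

Lemma linear_sys (R : pzRingType) (A B : rmodType R) (f : {linear A -> B}) n
    (a : 'I_n -> R^c) (x : 'I_n -> A) :
  f (\sum_(j < n) a j *: x j) = \sum_(j < n) a j *: f (x j).
Proof. by rewrite linear_sum; apply: eq_bigr => j _; rewrite linearZ. Qed.

Section Products.
Context (R : pzRingType) (A B : rmodType R).

Lemma inl_linear : linear (fun a : A => (a, 0 : B)).
Proof. by move=> r x y; congr pair; rewrite /= scaler0 addr0. Qed.
Definition in_l : {linear A -> (A * B)%type} := mklin inl_linear.

Lemma inr_linear : linear (fun b : B => (0 : A, b)).
Proof. by move=> r x y; congr pair; rewrite /= scaler0 addr0. Qed.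
Definition in_r : {linear B -> (A * B)%type} := mklin inr_linear.

Lemma in_lrE p : p = in_l p.1 + in_r p.2.
Proof. by case: p => a b; congr pair; rewrite /= ?addr0 ?add0r. Qed.

Lemma fst_linear : linear (fun p : A * B => p.1). Proof. by []. Qed.
Lemma snd_linear : linear (fun p : A * B => p.2). Proof. by []. Qed.
Definition pr_l : {linear (A * B)%type -> A} := mklin fst_linear.
Definition pr_r : {linear (A * B)%type -> B} := mklin snd_linear.

End Products.

Lemma map_l_linear (R : pzRingType) (A A' B : rmodType R) (f : {linear A -> A'}) :
  linear (fun p : A * B => (f p.1, p.2)).
Proof. by move=> r x y; congr pair; rewrite /= linearP. Qed.
Definition map_l (R : pzRingType) (A A' B : rmodType R) (f : {linear A -> A'}) :
  {linear (A * B)%type -> (A' * B)%type} := mklin (map_l_linear f).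

(** * Membership in a deconstructible class *)

Section Class.
Context (R : pzRingType) (k ks : cardinal) (D : mod_class R) (E : mor_class R).
Context (Rk : cle (R + nat)%type k) (ksP : succ_cardinal k ks).
Context (Ddec : deconstructible ks D).
Context (W : shapes)
  (EW : forall (A B : rmodType R) (f : {linear A -> B}), E f <-> injective f /\ spure W (range f)).
Implicit Types A B M N : rmodType R.

(** The factors that may occur in a filtration of a module of [D]. *)
Let C : mod_class R := fun N => D N /\ lt_presented ks N.
Notation demb f := (D_embedding D E f).

Lemma k_inf : cinfinite k.
Proof. by apply: cle_trans Rk; apply: (cle_inj (f := inr)) => x y []. Qed.

Lemma R_k : cle R k.
Proof. by apply: cle_trans Rk; apply: (cle_inj (f := inl)) => x y []. Qed.

Lemma C_small N : C N -> cle N k.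
Proof. by move=> [_ /(cle_presented k_inf R_k ksP)]. Qed.

Lemma C_zero : C (zero_mod R).
Proof.
split; last exact: zero_mod_presented ksP.
apply/Ddec/chain_filtered_filtered.
exists False, (fun _ _ => False), (fun _ => setT); split; try by case.
  by split; case.
by move=> x; left; exact: zero_mod_trivial.
Qed.

Lemma D_filtered M : D M <-> chain_filtered C M.
Proof.
split=> [/Ddec|/chain_filtered_filtered/Ddec //].
exact: filtered_chain (@zero_mod_trivial R) C_zero.
Qed.

Lemma D_glue (X Y P : rmodType R) (J : Type) (lt : J -> J -> Prop)
    (G : J -> set Y) (i : {linear X -> P}) (j : {linear Y -> P}) (B : set Y) :
  injective i -> (forall p, exists x y, p = i x + j y) ->
  (forall y, B y <-> exists x, j y = i x) ->
  D X -> filtration C lt G -> adapted lt G B -> D P.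
Proof.
move=> iI ij Bij /D_filtered DX GF BG; apply/D_filtered.
exact: (glue_filtered (@zero_mod_trivial R) C_zero iI ij Bij DX GF BG).
Qed.

Lemma D_iso A B (f : {linear A -> B}) :
  injective f -> (forall y, exists x, f x = y) -> D A -> D B.
Proof.
move=> fI fs DA; have /D_filtered[J [lt [G GF]]] := DA.
apply: (@D_glue A A B J lt G f f setT) => // [p|y|j].
- by have [x <-] := fs p; exists x, 0; rewrite linear0 addr0.
- by split=> // _; exists y.
- by right=> x _; exists 0; [left|exists x => //; rewrite add0r].
Qed.

Lemma submod_elt M (S : submodClosed M) (x : M) : x \in S -> exists u, submod_incl S u = x.
Proof. by move=> Sx; exists (exist _ x Sx : submod S). Qed.

Lemma submod_inclI M (S : submodClosed M) : injective (submod_incl S).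
Proof. exact: val_inj. Qed.

Lemma corestrict A M (S : submodClosed M) (f : {linear A -> M}) :
  (forall x, f x \in S) -> exists g : {linear A -> submod S}, forall x, submod_incl S (g x) = f x.
Proof.
move=> fS; have fl : linear (fun x => exist _ (f x) (fS x) : submod S).
  by move=> a x y; apply: val_inj; rewrite /= linearP.
by exists (mklin fl).
Qed.

Lemma linear_inj A B (f : {linear A -> B}) : (forall x, f x = 0 -> x = 0) -> injective f.
Proof.
move=> f0 x y fxy; apply/eqP; rewrite -subr_eq0; apply/eqP/f0.
by rewrite linearB fxy subrr.
Qed.

Lemma D_img A B (f : {linear A -> B}) : injective f -> D A -> D (submod (img f)).
Proof.
move=> fI; have [x|g gE] := @corestrict _ _ (img f) f; first by apply/asboolP; exists x.
apply: (D_iso (f := g)) => [x y /(congr1 (submod_incl _))|[y yf]].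
  by rewrite !gE => /fI.
by have /asboolP[x xy] := yf; exists x; apply: submod_inclI; rewrite gE.
Qed.

Lemma dembE A B (f : {linear A -> B}) :
  demb f <-> [/\ D A, D B, injective f & spure W (range f)].
Proof.
rewrite -img_range -range_incl; split=> [[DA DB fI [_ _ /EW[_ fp]]]//|[DA DB fI fp]].
split=> //; split=> //; first exact: D_img.
by apply/EW; split=> //; exact: val_inj.
Qed.

Lemma leE_incl A (B : submodClosed A) : leE D E B <-> demb (submod_incl B).
Proof.
split=> [[DB DA EB]|/dembE[DB DA BI Bp]]; last by split=> //; exact/EW.
by apply/dembE; split=> //; have /EW[] := EB.
Qed.

Lemma demb_id A : D A -> demb (idfun : {linear A -> A}).
Proof.
move=> DA; apply/dembE; split=> // m n a b _ _ [x xb].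
by exists x => // j; exists (x j).
Qed.

Lemma demb_comp (A B M : rmodType R) (f : {linear A -> B}) (g : {linear B -> M}) :
  demb f -> demb g -> demb (g \o f).
Proof.
move=> /dembE[DA DB fI fp] /dembE[_ DM gI gp]; apply/dembE; split=> //.
  exact: inj_comp.
exact: spure_comp.
Qed.

Lemma D_prod A B : D A -> D B -> D (A * B)%type.
Proof.
move=> DA /D_filtered[J [lt [G GF]]].
apply: (@D_glue A B (A * B)%type J lt G (in_l A B) (in_r A B) [set 0]) => //.
- by move=> x y [].
- by move=> p; exists p.1, p.2; exact: in_lrE.
- by move=> y; split=> [-> |[x [_ ->]]] //; exists 0.
- by move=> j; left=> x [-> _]; left.
Qed.

Lemma demb_in_l A B : D A -> D B -> demb (in_l A B).
Proof.
move=> DA DB; apply/dembE; split=> //; first exact: D_prod.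
  by move=> x y [].
move=> m n a b _ bA [x xb]; exists (fun j => in_l A B (x j).1) => [j|i]; first by exists (x j).1.
rewrite -linear_sys -(linear_sys (pr_l A B)) xb.
by have [y _ <-] := bA i.
Qed.

Lemma demb_map_l A A' B (f : {linear A -> A'}) : D B -> demb f -> demb (map_l B f).
Proof.
move=> DB /dembE[DA DA' fI fp]; apply/dembE; split; try exact: D_prod.
  by move=> [x y] [x' y'] [/fI -> ->].
move=> m n a b Wmn bA [x xb].
have [||y yf yb] := fp m n a (fun i => (b i).1) Wmn.
- by move=> i; have [c _ <-] := bA i; exists c.1.
- exists (fun j => (x j).1) => i; rewrite -xb; exact/esym/(linear_sys (pr_l A' B)).
exists (fun j => (y j, (x j).2)) => [j|i].
  by have [z _ <-] := yf j; exists (z, (x j).2).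
rewrite [RHS]surjective_pairing -(yb i) -[in RHS]xb.
rewrite [LHS]surjective_pairing; congr pair.
  exact: (linear_sys (pr_l A' B)).
rewrite [RHS](linear_sys (pr_r A' B)); exact: (linear_sys (pr_r A' B)).
Qed.

(** A nonzero module of [D] has a nonzero factor, and infinitely many copies of
that factor form an infinite module of [D]. *)
Lemma D_infinite : (forall M, D M -> trivial_mod M) \/
  exists2 K, D K & cinfinite (mcard K).
Proof.
have [triv|/existsNP[M /not_implyP[DM /existsNP[x x0]]]] :=
  pselect (forall M, D M -> trivial_mod M); [by left|right].
have /D_filtered[J [lt [G GF]]] := DM.
have [j Gx bx] := first_index GF x0; have [_ _ _ _ /(_ j)[N CN [f [_ _ fk]]]] := GF.
have fx0 : f x <> 0 by move=> /(fk _ Gx).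
pose upto n : set (nat -> N) := [set c | forall i, (n <= i)%N -> c i = 0].
have uptom n : subm (upto n).
  split=> // a c d c0 d0 i ni.
  by rewrite -[LHS]/(a *: c i + d i) c0 // d0 // scaler0 addr0.
have mono m n : (m <= n)%N -> upto m `<=` upto n.
  by move=> mn c c0 i ni; apply: c0; exact: leq_trans ni.
have Sm : subm (\bigcup_n upto n).
  split; first by exists 0%N => //; exact: subm0.
  move=> a c d [m _ cm] [n _ dn]; exists (maxn m n) => //; apply: (uptom _).2.
    exact: mono (leq_maxl _ _) _ cm.
  exact: mono (leq_maxr _ _) _ dn.
pose elt c (cS : c \in setsub Sm) : submod (setsub Sm) := exist _ c cS.
exists (submod (setsub Sm)); last first.
  have dS n : (fun i => if i == n then f x else 0) \in setsub Sm.
    by apply/asboolP; exists n.+1 => // i; case: eqVneq => // ->; rewrite ltnn.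
  apply/cleP; exists (fun n => elt _ (dS n)) => m n /(congr1 val).
  by move=> /(congr1 (@^~ m)) /=; rewrite eqxx; case: eqVneq.
pose incl := submod_incl (setsub Sm).
apply/D_filtered; exists nat, (fun m n => (m < n)%N : Prop), (fun n => incl @^-1` upto n.+1).
have bE n : below (fun m n => (m < n)%N : Prop) (fun n => incl @^-1` upto n.+1) n =
    incl @^-1` upto n.
  apply/seteqP; split=> [c [->|[i im ci]]|c cn].
  - exact: (subm0 (subm_preimage incl (uptom n))).
  - exact: mono im _ ci.
  - case: n cn => [|n] cn; last by right; exists n => /=.
    by left; apply: val_inj; apply/funext => i; exact: cn.
split=> [|n|m n mn|c|n].
- split=> [n|m n]; last by case: (ltngtP m n); [constructor 1|constructor 3|constructor 2].
  elim: n {-2}n (leqnn n) => [|n IH] m mn; constructor=> l lm.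
    by move: lm; rewrite (eqP (_ : m == 0%N)) // -leqn0.
  by apply: IH; rewrite -ltnS; exact: leq_trans mn.
- exact: subm_preimage.
- by move=> c; apply: mono; exact: ltnW.
- by right; have /asboolP[n _ cn] := valP c; exists n; exact: mono cn.
rewrite bE; exists N => //; exists (fun c => val c n); split=> // [y|c cn].
  have yS : (fun i => if i == n then y else 0) \in setsub Sm.
    by apply/asboolP; exists n.+1 => // i; case: eqVneq => // ->; rewrite ltnn.
  exists (elt _ yS); last by rewrite /= eqxx.
  by move=> i /=; case: eqVneq => // ->; rewrite ltnn.
split=> [c0 i|]; last exact.
by rewrite leq_eqVlt => /predU1P[<- //|]; exact: cn.
Qed.

(** * Small hulls in a pair of extensions *)

(** The closure conditions on the small submodules [S] of [M]; [A] is the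
submodule modulo which [S] has to be pure as well. *)
Definition nice M (A : set M) (J : Type) (lt : J -> J -> Prop) (G : J -> set M) (S : set M) :=
  [/\ subm S, adapted lt G S, pure_mod [set 0] S & pure_mod A S].

Lemma finitary_nice M (A : set M) (J : Type) (lt : J -> J -> Prop) (G : J -> set M) :
  filtration C lt G -> finitary k (nice A lt G).
Proof.
move=> GF; have fin := finitary_and k_inf
  (finitary_and k_inf (finitary_subm M k_inf R_k) (finitary_adapted k_inf C_small GF))
  (finitary_and k_inf (finitary_pure_mod [set 0] k_inf R_k) (finitary_pure_mod A k_inf R_k)).
by apply: finitary_sub fin => S [[Sm SA] [Sp SpA]].
Qed.

(** All three submodules are found at once, as the traces of one Skolem hull in
the disjoint union of the modules; the inclusions and their inverses are among the
operations, which forces [S1] and [S2] to meet [A] in the same submodule. *)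
Lemma common_hull A N1 N2 (JA J1 J2 : Type)
    (ltA : JA -> JA -> Prop) (GA : JA -> set A) (lt1 : J1 -> J1 -> Prop) (G1 : J1 -> set N1)
    (lt2 : J2 -> J2 -> Prop) (G2 : J2 -> set N2)
    (i1 : {linear A -> N1}) (i2 : {linear A -> N2}) (b1 : N1) (b2 : N2) :
  filtration C ltA GA -> filtration C lt1 G1 -> filtration C lt2 G2 ->
  injective i1 -> injective i2 ->
  exists (B : set A) (S1 : set N1) (S2 : set N2),
    [/\ [/\ nice [set 0] ltA GA B, nice (range i1) lt1 G1 S1 & nice (range i2) lt2 G2 S2],
        S1 b1 /\ S2 b2,
        (forall a, B a <-> S1 (i1 a)) /\ (forall a, B a <-> S2 (i2 a))
      & cle {a | B a} k].
Proof.
move=> GFA GF1 GF2 i1I i2I.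
have linv (N : rmodType R) (i : {linear A -> N}) : injective i -> exists i' : N -> A, cancel i i'.
  move=> iI; have /choice[i' i'P] : forall n, exists a, forall a', i a' = n -> a' = a.
    move=> n; have [[a an]|na] := pselect (exists a, i a = n).
      by exists a => a' a'n; apply: iI; rewrite an.
    by exists 0 => a an; case: na; exists a.
  by exists i' => a; exact/esym/i'P.
have [i1' i1K] := linv _ _ i1I; have [i2' i2K] := linv _ _ i2I.
pose T := (A + (N1 + N2))%type.
pose e1 (n : N1) : T := inr (inl n); pose e2 (n : N2) : T := inr (inr n).
pose f (d : bool) (x : T) : T := match x with
  | inl a => if d then e1 (i1 a) else e2 (i2 a)
  | inr (inl n) => if n == i1 (i1' n) then inl (i1' n) else x
  | inr (inr n) => if n == i2 (i2' n) then inl (i2' n) else x end.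
have boolk : cle bool k.
  by apply: cle_trans k_inf; apply: (cle_inj (f := nat_of_bool)) => -[] [].
have inlI : injective (inl : A -> T) by move=> x y [].
have e1I : injective e1 by move=> x y [].
have e2I : injective e2 by move=> x y [].
have fin := finitary_and k_inf (finitary_and k_inf
    (finitary_preimage inlI (finitary_nice [set 0] GFA))
    (finitary_and k_inf (finitary_preimage e1I (finitary_nice (range i1) GF1))
                        (finitary_preimage e2I (finitary_nice (range i2) GF2))))
  (finitary_and k_inf (finitary_op1 f boolk)
    (finitary_and k_inf (finitary_mem k_inf (e1 b1)) (finitary_mem k_inf (e2 b2)))).
have [ev [[nA [n1 n2]] [fS [Sb1 Sb2]]]] := finitary_hull (inl 0 : T) fin.
exists (inl @^-1` range ev), (e1 @^-1` range ev), (e2 @^-1` range ev); split=> //.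
- split=> a; split=> /= h.
  + exact: (fS true _ h).
  + by have := fS true _ h; rewrite /= i1K eqxx.
  + exact: (fS false _ h).
  + by have := fS true _ h; rewrite /= i2K eqxx.
- apply: cle_trans (cle_tree k_inf).
  have /choice[u uE] : forall a : {a | (inl @^-1` range ev) a}, exists u, ev u = inl (sval a).
    by move=> [a aP] /=; have [u _ ua] := aP; exists u.
  apply: (cle_inj (f := u)) => a a' uaa'; apply: sval_inj.
  by apply: inlI; rewrite -!uE uaa'.
Qed.

(** The pushout of the inclusion of [B] into [A] and the restriction of [v] to
[B]. *)
Lemma pushout A (U : rmodType R) (v : {linear A -> U}) (B : set A) : subm B ->
  exists (P : rmodType R) (i : {linear U -> P}) (j : {linear A -> P}),
    (forall p, exists u a, p = i u + j a) /\
    (forall u a, i u + j a = 0 <-> exists2 b, B b & u = v b /\ a = - b).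
Proof.
move=> Bm; pose K : set (U * A)%type := [set p | exists2 b, B b & p = (v b, - b)].
have Km : subm K.
  split; first by exists 0; [exact: subm0|rewrite linear0 oppr0].
  move=> r _ _ [b Bb ->] [b' Bb' ->]; exists (r *: b + b'); first exact: Bm.2.
  by congr pair; rewrite /= ?linearP // opprD scalerN.
pose pr := qproj (setsub Km).
have prE u a : pr (u, a) = pr (in_l U A u) + pr (in_r U A a).
  by rewrite [in LHS](in_lrE (u, a)) linearD.
exists (qmod (setsub Km)), (pr \o in_l U A), (pr \o in_r U A); split.
  by apply: qpiP => -[u a]; exists u, a; exact: prE.
move=> u a; rewrite -[X in X = 0]prE qproj_eq0 mem_setsub.
by split=> [[b Bb [-> ->]]|[b Bb [-> ->]]]; exists b.
Qed.

(** * Amalgamation and types *)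

Section Amalgamation.
Context (AP : amalgamation D E).

(** Adding an infinite direct summand removes the restriction of the amalgamation
property to infinite modules. *)
Lemma amalgamate (A0 A1 A2 : rmodType R) (f1 : {linear A0 -> A1}) (f2 : {linear A0 -> A2}) :
  demb f1 -> demb f2 -> exists (A3 : rmodType R) (g1 : {linear A1 -> A3}) (g2 : {linear A2 -> A3}),
    [/\ demb g1, demb g2 & forall x, g1 (f1 x) = g2 (f2 x)].
Proof.
move=> f1D f2D; have /dembE[D0 D1 _ _] := f1D; have /dembE[_ D2 _ _] := f2D.
have [triv|[K DK Kinf]] := D_infinite.
  exists A1, idfun, (\0 : {linear A2 -> A1}); split=> [||x]; first exact: demb_id.
    apply/dembE; split=> // [x y _|m n a b _ _ _]; first by rewrite (triv _ D2 x) (triv _ D2 y).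
    by exists (fun=> 0) => [j|i]; [exists 0|rewrite (triv _ D1 (b i)) (triv _ D1 (\sum_j _))].
  by rewrite (triv _ D0 x) !linear0.
pose L : cardinal := (mcard (A0 * K)%type + (mcard (A1 * K)%type + mcard (A2 * K)%type))%type.
have inf A : cinfinite (mcard (A * K)%type).
  apply: cle_trans Kinf _; apply: (cle_inj (f := fun x => (0 : A, x))) => x y [] //.
have le0 : cle (mcard (A0 * K)%type) L by apply: (cle_inj (f := inl)) => x y [].
have le1 : cle (mcard (A1 * K)%type) L by apply: (cle_inj (f := fun x => inr (inl x))) => x y [].
have le2 : cle (mcard (A2 * K)%type) L by apply: (cle_inj (f := fun x => inr (inr x))) => x y [].
have Linf : cinfinite L by exact: cle_trans (inf A0) le0.
have [A3 [g1 [g2 [_ _ g1D g2D g12]]]] := AP Linf (demb_map_l DK f1D) (demb_map_l DK f2D)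
  (conj (inf A0) le0) (conj (inf A1) le1) (conj (inf A2) le2).
exists A3, (g1 \o in_l A1 K), (g2 \o in_l A2 K); split.
- exact: demb_comp (demb_in_l D1 DK) g1D.
- exact: demb_comp (demb_in_l D2 DK) g2D.
- by move=> x; exact: (g12 (x, 0)).
Qed.

Section Types.
Context (A : rmodType R) (I : Type).
Implicit Types t : triple D A I.

Lemma atomic_refl t : atomic E t t.
Proof. by have tD := demb_id (tmod_in t); exists (tmod t), idfun, idfun. Qed.

Lemma atomic_sym t u : atomic E t u -> atomic E u t.
Proof.
by move=> [N [f [g [fD gD fg fgt]]]]; exists N, g, f; split=> // x; rewrite ?fg ?fgt.
Qed.

(** Two amalgams are glued by amalgamating over their common middle module. *)
Lemma atomic_trans t u v : atomic E t u -> atomic E u v -> atomic E t v.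
Proof.
move=> [N [f [g [fD gD fg fgt]]]] [N' [f' [g' [fD' gD' fg' fgt']]]].
have [M [h [h' [hD hD' hh]]]] := amalgamate gD fD'.
exists M, (h \o f), (h' \o g'); split; try exact: demb_comp.
- move=> x; move: (fg x) (fg' x) => /= fgx fgx'.
  by rewrite fgx -fgx' hh.
- move=> x; move: (fgt x) (fgt' x) => /= fgx fgx'.
  by rewrite fgx -fgx' hh.
Qed.

Lemma gtp_eqP t u : gtp E t = gtp E u <-> atomic E t u.
Proof.
have clos (v w : triple D A I) : gtp E v w -> atomic E v w.
  by elim=> // x y z _ xy _; exact: atomic_trans xy.
split=> [tu|tu]; first by apply: clos; rewrite tu; left; exact: atomic_refl.
apply/funext => v; apply/propext; split=> h; apply: t_trans h; left => //.
exact: atomic_sym.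
Qed.

End Types.


(** The amalgamation that carries the proof.  The hypotheses on [P] say that it is
the pushout of [U] and [A] over [B].  As [S] meets [A] in [B], the submodule [S + A]
of [N] is the pushout of [S] and [A] over [B], so [h] induces a map from it to [P];
and [N] and [P] are amalgamated over this submodule. *)
Lemma amalgamate_pushout (A N U P : rmodType R) (JA J : Type)
    (ltA : JA -> JA -> Prop) (GA : JA -> set A) (lt : J -> J -> Prop) (G : J -> set N)
    (B : set A) (S : set N) (iA : {linear A -> N}) (h : {linear N -> U})
    (i : {linear U -> P}) (j : {linear A -> P}) :
  filtration C ltA GA -> adapted ltA GA B ->
  filtration C lt G -> nice (range iA) lt G S ->
  (forall a, B a <-> S (iA a)) -> demb iA -> demb h -> D P ->
  (forall p, exists u a, p = i u + j a) ->
  (forall u a, i u + j a = 0 <-> exists2 b, B b & u = h (iA b) /\ a = - b) ->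
  exists (M : rmodType R) (g : {linear N -> M}) (l : {linear P -> M}),
    [/\ demb g, demb l, forall a, l (j a) = g (iA a) & forall c, S c -> l (i (h c)) = g c].
Proof.
move=> GFA BA GF [Sm SA Sp SpA] BS /dembE[DA DN iI ip] /dembE[_ DU hI hp] DP ijP ijK.
have Qm : subm [set x + y | x in S & y in range iA].
  by apply: subm_add => //; exact: subm_range.
pose Q := setsub Qm.
have QP c a : S c -> c + iA a \in Q.
  by move=> Sc; apply/mem_setsub; exists c => //; exists (iA a).
have Qex (w : submod Q) : exists c a, S c /\ submod_incl Q w = c + iA a.
  have /mem_setsub[c Sc [_ [a _ <-] ca]] := valP w.
  by exists c, a.
have DQ : D (submod Q).
  have DS : D (submod (setsub Sm)).
    apply/D_filtered/(adapted_filtered (@zero_mod_trivial R) C_zero GF).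
    by rewrite setsubE.
  have [x|q qE] := @corestrict _ _ Q (submod_incl (setsub Sm)).
    by rewrite -[submod_incl _ x]addr0 -(linear0 iA); apply/QP/(mem_setsub Sm)/valP.
  have [a|q' qE'] := @corestrict _ _ Q iA.
    by rewrite -[iA a]add0r; exact: QP (subm0 Sm).
  apply: (@D_glue _ A _ _ ltA GA q q' B) => //.
  - by move=> x y /(congr1 (submod_incl Q)); rewrite !qE => /submod_inclI.
  - move=> w; have [c [a [Sc wE]]] := Qex w.
    have [//|x xc] := @submod_elt _ (setsub Sm) c; first exact/mem_setsub.
    by exists x, a; apply: submod_inclI; rewrite linearD wE qE qE' xc.
  - move=> a; split=> [/BS Sa|[x /(congr1 (submod_incl Q))]].
      have [|x xa] := @submod_elt _ (setsub Sm) (iA a); first exact/mem_setsub.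
      by exists x; apply: submod_inclI; rewrite qE qE'.
    by rewrite qE qE' => aE; apply/BS; rewrite aE; apply/(mem_setsub Sm)/valP.
have demb_q : demb (submod_incl Q).
  apply/dembE; split=> //.
  by rewrite range_incl setsubE; apply: spure_add => //; exact: subm_range.
(* the map from [S + A] to [P] is well defined because [S] meets [A] in [B] *)
have wd c a c' a' : S c -> S c' -> c + iA a = c' + iA a' ->
    i (h c) + j a = i (h c') + j a'.
  move=> Sc Sc' e.
  have e' : c - c' = iA (a' - a).
    by rewrite linearB; apply/eqP; rewrite subr_eq addrAC eq_sym subr_eq e addrC.
  have /ijK e0 : exists2 b, B b & h (c - c') = h (iA b) /\ a - a' = - b.
    exists (a' - a); last by rewrite e' opprB.
    by apply/BS; rewrite -e'; exact: submB.
  apply/eqP; rewrite -subr_eq0 opprD addrACA -!linearB; exact/eqP.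
have /choice[phi phiE] : forall w : submod Q, exists p, forall c a, S c ->
    submod_incl Q w = c + iA a -> p = i (h c) + j a.
  move=> w; have [c [a [Sc wE]]] := Qex w.
  by exists (i (h c) + j a) => c' a' Sc' wE'; apply: wd; rewrite -?wE.
have phil : linear phi.
  move=> r w w'; have [c [a [Sc wE]]] := Qex w; have [c' [a' [Sc' wE']]] := Qex w'.
  rewrite (phiE _ _ _ Sc wE) (phiE _ _ _ Sc' wE') (phiE _ (r *: c + c') (r *: a + a')).
  - by rewrite !linearP scalerDr addrACA.
  - exact: Sm.2.
  - by rewrite !linearP wE wE' scalerDr addrACA.
have phiI : injective (mklin phil).
  apply: linear_inj => w /= w0; have [c [a [Sc wE]]] := Qex w.
  move: w0; rewrite /lin_fun (phiE _ _ _ Sc wE) => /ijK[b Bb [/hI cb ab]].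
  by apply: submod_inclI; rewrite wE cb ab linearN subrr linear0.
(* Purity of the image: a solution in [P] has components in [U] and in [A] which
   solve the component systems up to elements of [B]; these can be absorbed into the
   right-hand sides in [S], after which only the component in [U] is corrected. *)
have demb_phi : demb (mklin phil).
  apply/dembE; split=> // m n r b Wmn bQ [p pb].
  have /choice[x /choice[y pE]] : forall l, exists u a, p l = i u + j a by [].
  have /choice[ca caE] : forall v, exists ca : N * A, S ca.1 /\ b v = i (h ca.1) + j ca.2.
    move=> v; have [w _ <-] := bQ v; have [c [a [Sc wE]]] := Qex w.
    by exists (c, a); split=> //; exact: phiE.
  have sumP z v : \sum_(l < n) r v l *: (i (z l) + j (y l)) =
      i (\sum_(l < n) r v l *: z l) + j (\sum_(l < n) r v l *: y l).
    by rewrite !linear_sys -big_split; apply: eq_bigr => l _; rewrite scalerDr.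
  have /choice[d dE] : forall v, exists d, S d /\ \sum_(l < n) r v l *: x l = h d.
    move=> v; have [Sc bE] := caE v.
    have : i (\sum_(l < n) r v l *: x l - h (ca v).1) +
           j (\sum_(l < n) r v l *: y l - (ca v).2) = 0.
      rewrite !linearB addrACA -opprD -bE -sumP -pb.
      by apply/eqP; rewrite subr_eq0; apply/eqP; apply: eq_bigr => l _; rewrite pE.
    move=> /ijK[b' Bb' [/eqP]]; rewrite subr_eq -linearD => /eqP -> _.
    by exists (iA b' + (ca v).1); split=> //; apply: submD => //; exact/BS.
  have hSp : spure W (h @` S).
    apply: (spure_comp (f := idfun) (g := h)) => //.
    by rewrite image_id; exact: pure_mod0.
  have [||z zS zE] := hSp m n r (fun v => h (d v)) Wmn.
  - by move=> v; exists (d v) => //; have [] := dE v.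
  - by exists x => v; have [] := dE v.
  exists (fun l => i (z l) + j (y l)) => [l|v].
    have [c Sc cz] := zS l; have [w wE] := submod_elt (QP c (y l) Sc).
    by exists w => //=; rewrite /lin_fun (phiE w c (y l)) ?cz.
  rewrite sumP zE -pb; have [_ <-] := dE v; rewrite -sumP.
  by apply: eq_bigr => l _; rewrite pE.
have [M [g [l [gD lD gl]]]] := amalgamate demb_q demb_phi.
have glE c a : S c -> l (i (h c) + j a) = g (c + iA a).
  move=> Sc; have [w wE] := submod_elt (QP c a Sc).
  by rewrite -wE gl /= /lin_fun (phiE w c a).
exists M, g, l; split=> // [a|c Sc].
  by rewrite -[j a]add0r -(linear0 i) -(linear0 h) glE ?add0r //; exact: subm0.
by rewrite -[i _]addr0 -(linear0 j) glE // linear0 addr0.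
Qed.

(** If the types agree on the small submodule [B] of the hull, then the amalgam [U]
of the two extensions over [B] identifies the two elements, and so does the pushout
[P] of [U] and [A] over [B], which contains just one copy of [A].  Each
extension is amalgamated with [P], and the results are amalgamated over [P]. *)
Theorem class_tame : tame D E k.
Proof.
move=> A DA p q [t1 i1D ->] [t2 i2D ->] pq.
apply: contrapT => noB; apply: pq; apply/gtp_eqP.
have /dembE[_ D1 i1I i1p] := i1D; have /dembE[_ D2 i2I i2p] := i2D.
have /D_filtered[JA [ltA [GA GFA]]] := DA.
have /D_filtered[J1 [lt1 [G1 GF1]]] := D1.
have /D_filtered[J2 [lt2 [G2 GF2]]] := D2.
have [B [S1 [S2 [[nB n1 n2] [Sb1 Sb2] [BS1 BS2] Bk]]]] :=
  common_hull (ttup t1 tt) (ttup t2 tt) GFA GF1 GF2 i1I i2I.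
have [Bm BA Bp _] := nB.
pose B' := setsub Bm.
have DB : D (submod B').
  apply/D_filtered/(adapted_filtered (@zero_mod_trivial R) C_zero GFA).
  by rewrite setsubE.
have leB : leE D E B'.
  apply/leE_incl/dembE; split=> //.
  by rewrite range_incl setsubE; exact: pure_mod0.
have Bk' : cle (mcard (submod B')) k.
  apply: cle_trans Bk; have vB (x : submod B') : B (val x) by apply/(mem_setsub Bm)/valP.
  apply/cleP; exists (fun x => exist _ (val x) (vB x)) => x y /(congr1 sval).
  exact: val_inj.
have : gtp_restr E (gtp E t1) (B := B') = gtp_restr E (gtp E t2) (B := B').
  by apply: contrapT => ne; apply: noB; exists B'.
rewrite !gtp_restrE; try exact: atomic_refl.
move=> /gtp_eqP[U [h1 [h2 [h1D h2D h12 hb]]]].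
have hB b : B b -> h1 (tincl t1 b) = h2 (tincl t2 b).
  move=> Bb; have [|x xb] := @submod_elt _ B' b; first exact/mem_setsub.
  by rewrite -xb; exact: (h12 x).
have [P [i [j [ijP ijK]]]] := pushout (h1 \o tincl t1) Bm.
have ijK' u a : i u + j a = 0 <-> exists2 b, B b & u = h2 (tincl t2 b) /\ a = - b.
  rewrite ijK; split=> -[b Bb [-> ->]]; exists b => //; split=> //; last exact/esym/hB.
  exact: hB.
have /dembE[_ DU _ _] := h1D.
have DP : D P.
  apply: (@D_glue U A P JA ltA GA i j B) => // [|a].
    apply: linear_inj => u iu; have /ijK[b _ [-> /esym/eqP]] : i u + j 0 = 0.
      by rewrite iu linear0 addr0.
    by rewrite oppr_eq0 => /eqP ->; rewrite linear0.
  split=> [Ba|[u ju]].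
    exists (- h1 (tincl t1 (- a))); apply/eqP; rewrite linearN -addr_eq0 addrC; apply/eqP/ijK.
    by exists (- a); [exact: submN|rewrite opprK].
  have /ijK[b Bb [_ ->]] : i (- u) + j a = 0 by rewrite linearN ju addNr.
  exact: submN.
have [M1 [g1 [l1 [g1D l1D e1 c1]]]] :=
  amalgamate_pushout GFA BA GF1 n1 BS1 i1D h1D DP ijP ijK.
have [M2 [g2 [l2 [g2D l2D e2 c2]]]] :=
  amalgamate_pushout GFA BA GF2 n2 BS2 i2D h2D DP ijP ijK'.
have [M [m1 [m2 [m1D m2D m12]]]] := amalgamate l1D l2D.
exists M, (m1 \o g1), (m2 \o g2); split; try exact: demb_comp.
- by move=> a /=; rewrite -e1 -e2 m12.
- by case=> /=; rewrite -c1 // -c2 // m12; congr (m2 (l2 (i _))); exact: (hb tt).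
Qed.

End Amalgamation.
End Class.

Theorem corollary3p24 (R : pzRingType) (kappa kappa_succ : cardinal)
  (D : mod_class R) (E : mor_class R) :
  cle (R + nat)%type kappa ->
  succ_cardinal kappa kappa_succ ->
  deconstructible kappa_succ D ->
  E = @embedding R \/ E = @RD_embedding R \/ E = @pure_embedding R ->
  amalgamation D E ->
  tame D E kappa.
Proof.
move=> Rk ksP Ddec /embedding_shape[W EW] AP.
exact: (class_tame Rk ksP Ddec EW AP).
Qed.
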